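(* Let $[a,b]=[a_1,b_1]\times\cdots\times[a_d,b_d]\subseteq\mathbb{R}^d$, let $c\in[a,b]$ be an anchor, write $\mathfrak D=\{1,\ldots,d\}$, and let $\gamma_u>0$, $u\subseteq\mathfrak D$, be weights. For any $f\in H^1_{\mathrm{mix}}([a,b])$ and any downward closed set $\Lambda$ of subsets of $\mathfrak D$, with complement $\complement\Lambda$ in the power set of $\mathfrak D$, the error bound $$\|f-f_\Lambda\|_{L_\infty([a,b])}\le C_{emb}\left(\sum_{u\in\complement\Lambda}\widetilde K_u(a,b)\,\gamma_u^{1/2}\right)\|f\|_{H^1_{c;\gamma}([a,b])}$$ holds. If $0\le b_j-a_j\le1$ for $1\le j\le d$, this bound simplifies to $$\|f-f_\Lambda\|_{L_\infty([a,b])}\le C_{emb}\left(\sum_{u\in\complement\Lambda}2^{\#u/2}\gamma_u^{1/2}\right)\|f\|_{H^1_{c;\gamma}([a,b])}.$$ In any case, $C_{emb}$ is the constant of the continuous embedding $H^1_{\mathrm{mix}}([a,b])\to L_\infty([a,b])$ and $$\widetilde K_u(a,b)=\left(\prod_{j\in\mathfrak D\setminus u}(b_j-a_j)\right)^{1/2}2^{\#u/2}\prod_{j\in u}(b_j-a_j).$$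
   Context: Here $a_j<b_j$. $\Lambda$ is downward closed if $u\in\Lambda$, $v\subseteq u$ imply $v\in\Lambda$. $H^1_{\mathrm{mix}}([a,b])=\{f\in L_2([a,b]):D^\alpha f\in L_2([a,b])\text{ for all }\alpha\in\mathbb{N}_0^d,\ \|\alpha\|_\infty\le1\}$, with norm $\|f\|^2_{H^1_{\mathrm{mix}}([a,b])}=\sum_{\|\alpha\|_\infty\le1}\|D^\alpha f\|^2_{L_2([a,b])}$; its elements are identified with their continuous representatives. $C_{emb}$ satisfies $\|g\|_{L_\infty([a,b])}\le C_{emb}\|g\|_{H^1_{\mathrm{mix}}([a,b])}$ for all $g\in H^1_{\mathrm{mix}}([a,b])$. For $u\subseteq\mathfrak D$, $[a_u,b_u]=\prod_{j\in u}[a_j,b_j]$, and $(x;c)_u\in[a,b]$ has $j$-th component $x_j$ for $j\in u$ and $c_j$ for $j\notin u$. The anchored components of $f$ are $f_{u;c}(x_u)=\sum_{v\subseteq u}(-1)^{\#u-\#v}f((x;c)_v)$, and $f_\Lambda:=\sum_{u\in\Lambda}f_{u;c}$. With $D^u$ the mixed first derivative in all variables with index in $u$, the weighted norm is $$\|f\|^2_{H^1_{c;\gamma}([a,b])}=\sum_{u\subseteq\mathfrak D}\gamma_u^{-1}\|D^uf((\cdot;c)_u)\|^2_{L_2([a_u,b_u])},$$ where $f((\cdot;c)_u)$ is regarded as a function on $[a_u,b_u]$ and the term for $u=\emptyset$ is $\gamma_\emptyset^{-1}|f(c)|^2$. *)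

(* Defs.v *)
From HB Require Import structures.
From mathcomp Require Import all_boot all_order all_algebra.
From mathcomp Require Import all_classical all_reals all_analysis.

Set Implicit Arguments.
Unset Strict Implicit.
Unset Printing Implicit Defensive.

Import Order.TTheory GRing.Theory Num.Theory.
Import numFieldNormedType.Exports.

Local Open Scope classical_set_scope.
Local Open Scope ring_scope.

(* The library has neither a sigma-algebra nor a Lebesgue measure on 'rV[R]_n.
   Here 'rV[R]_n gets the product (= Borel) sigma-algebra, generated by the
   coordinates, exactly as the library does for n.-tuple. *)

Definition rV_display : measure_display.
Proof. exact: default_measure_display. Qed.

Section measurable_rV.
Context {R : realType} (n : nat).

Let coord (j : 'I_n) (x : 'rV[R]_n) : measurableTypeR R := x ord0 j.

Let rV_set0 : g_sigma_preimage coord set0.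
Proof. exact: sigma_algebra0. Qed.

Let rV_setC A : g_sigma_preimage coord A -> g_sigma_preimage coord (~` A).
Proof. exact: sigma_algebraC. Qed.

Let rV_bigcup (F : _^nat) : (forall i, g_sigma_preimage coord (F i)) ->
  g_sigma_preimage coord (\bigcup_i (F i)).
Proof. exact: sigma_algebra_bigcup. Qed.

HB.instance Definition _ := @isMeasurable.Build rV_display
  'rV[R]_n (g_sigma_preimage coord) rV_set0 rV_setC rV_bigcup.

Lemma measurable_coord (j : 'I_n) :
  measurable_fun setT (fun x : 'rV[R]_n => x ord0 j).
Proof.
move=> _ Y mY; rewrite setTI; apply: sub_sigma_algebra => /=.
rewrite -bigcup_seq/=; exists j => /=; first by rewrite mem_index_enum.
by exists Y => //; rewrite setTI.
Qed.

Lemma measurable_fun_rV d (T : measurableType d) (f : T -> 'rV[R]_n) :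
  (forall j, measurable_fun setT (fun t => f t ord0 j)) ->
  measurable_fun setT f.
Proof.
move=> mf _ A mA; rewrite setTI.
have : preimage_set_system setT f (g_sigma_preimage coord) (f @^-1` A).
  by exists A => //; rewrite setTI.
rewrite -g_sigma_preimage_comp => H; apply: (smallest_sub _ _ H).
  exact: sigma_algebra_measurable.
by move=> B; rewrite -bigcup_seq => -[i _ [C mC <-]]; exact: mf.
Qed.

End measurable_rV.

Section lebesgue_rV.
Context {R : realType}.

Definition rV_cons n (p : measurableTypeR R * 'rV[R]_n) : 'rV[R]_n.+1 :=
  \row_j oapp (p.2 ord0) p.1 (unlift ord0 j).

Lemma rV_cons0 n p : @rV_cons n p ord0 ord0 = p.1.
Proof. by rewrite mxE unlift_none. Qed.

Lemma rV_consS n p j : @rV_cons n p ord0 (lift ord0 j) = p.2 ord0 j.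
Proof. by rewrite mxE liftK. Qed.

Lemma measurable_rV_cons n : measurable_fun setT (@rV_cons n).
Proof.
apply: measurable_fun_rV => j; rewrite /rV_cons.
under eq_fun do rewrite mxE.
case: unliftP => [k _|_] /=; last exact: measurable_fst.
exact: (measurableT_comp (measurable_coord k) measurable_snd).
Qed.

Section lebesgue_cons.
Variables (n : nat) (m : {sigma_finite_measure set 'rV[R]_n -> \bar R}).

Definition lebesgue_cons : set 'rV[R]_n.+1 -> \bar R :=
  pushforward (@lebesgue_measure R \x m)%E (@rV_cons n).

Let measurable_preimage A : measurable A -> measurable (@rV_cons n @^-1` A).
Proof.
by move=> mA; rewrite -[X in measurable X]setTI; exact: (measurable_rV_cons measurableT).
Qed.

Let lebesgue_cons0 : lebesgue_cons set0 = 0%E.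
Proof. by rewrite /lebesgue_cons /pushforward preimage_set0 measure0. Qed.

Let lebesgue_cons_ge0 A : (0 <= lebesgue_cons A)%E.
Proof. by rewrite /lebesgue_cons /pushforward; exact: measure_ge0. Qed.

Let lebesgue_cons_sigma_additive : semi_sigma_additive lebesgue_cons.
Proof.
move=> F mF tF mUF; rewrite /lebesgue_cons /pushforward preimage_bigcup.
apply: measure_semi_sigma_additive.
- by move=> k; exact: measurable_preimage.
- apply/trivIsetP => /= i j _ _ ij; rewrite -preimage_setI.
  by move/trivIsetP : tF => /(_ _ _ _ _ ij) ->//; rewrite preimage_set0.
- by rewrite -preimage_bigcup; exact: measurable_preimage.
Qed.

HB.instance Definition _ := isMeasure.Build _ _ _ lebesgue_cons
  lebesgue_cons0 lebesgue_cons_ge0 lebesgue_cons_sigma_additive.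

Lemma lebesgue_consE (A : 'I_n.+1 -> set (measurableTypeR R)) :
  (forall j, measurable (A j)) ->
  lebesgue_cons [set x | forall j, A j (x ord0 j)] =
  (lebesgue_measure (A ord0) *
   m [set x | forall j, A (lift ord0 j) (x ord0 j)])%E.
Proof.
move=> mA; set B := (X in (_ * m X)%E); have mB : measurable B.
  have -> : B = \bigcap_j
      ((fun x : 'rV[R]_n => x ord0 j) @^-1` A (lift ord0 j)).
    by apply/seteqP; split => x /= => [H j _|H j]; exact: H.
  apply: fin_bigcap_measurable => // j _; rewrite -[X in measurable X]setTI.
  exact: (measurable_coord j measurableT (mA _)).
rewrite -(product_measure1E _ _ (mA ord0) mB).
rewrite /lebesgue_cons /pushforward; congr (_ _).
apply/seteqP; split => -[t x] /=.
  move=> H; split; first by have := H ord0; rewrite rV_cons0.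
  by move=> j; have := H (lift ord0 j); rewrite rV_consS.
move=> [/= At Ax] j; case: (unliftP ord0 j) => [k ->|->].
  by rewrite rV_consS.
by rewrite rV_cons0.
Qed.

Let lebesgue_cons_sigma_finite : sigma_finite setT lebesgue_cons.
Proof.
have /sigma_finiteP[F [FT ndF mF]] := sigma_finiteT (@lebesgue_measure R).
have /sigma_finiteP[G [GT ndG mG]] := sigma_finiteT m.
pose tl (x : 'rV[R]_n.+1) : (measurableTypeR R * 'rV[R]_n)%type :=
  (x ord0 ord0, \row_j x ord0 (lift ord0 j)).
have tlK x : tl (rV_cons x) = x.
  case: x => t x; rewrite /tl rV_cons0; congr pair.
  by apply/rowP => j; rewrite mxE rV_consS.
have mtl : measurable_fun setT tl.
  apply: measurable_fun_pair; first exact: measurable_coord.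
  apply: measurable_fun_rV => j /=.
  under eq_fun do rewrite mxE.
  exact: measurable_coord.
exists (fun k => tl @^-1` (F k `*` G k)).
  apply/esym; rewrite -subTset => x _.
  have : setT (tl x).1 by [].
  have : setT (tl x).2 by [].
  rewrite FT GT => -[k _ Gk] [l _ Fl]; exists (maxn k l) => //; split => /=.
    by move: Fl; exact/subsetPset/ndF/leq_maxr.
  by move: Gk; exact/subsetPset/ndG/leq_maxl.
move=> k; have [mFk Fk] := mF k; have [mGk Gk] := mG k; split.
  rewrite -[X in measurable X]setTI.
  exact: (mtl measurableT _ (measurableX mFk mGk)).
rewrite /lebesgue_cons /pushforward -comp_preimage.
have -> : tl \o @rV_cons n = id by apply/funext => x; exact: tlK.
by rewrite preimage_id product_measure1E// lte_mul_pinfty// ge0_fin_numE.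
Qed.

HB.instance Definition _ := Measure_isSigmaFinite.Build _ _ _ lebesgue_cons
  lebesgue_cons_sigma_finite.

End lebesgue_cons.

Section lebesgue_nil.

Definition lebesgue_nil : set 'rV[R]_0 -> \bar R := @dirac _ 'rV[R]_0 0 R.

HB.instance Definition _ := Measure.on lebesgue_nil.

Let lebesgue_nil_finite : fin_num_fun lebesgue_nil.
Proof. by move=> A mA; rewrite /lebesgue_nil diracE. Qed.

HB.instance Definition _ := Measure_isFinite.Build _ _ _ lebesgue_nil
  lebesgue_nil_finite.

End lebesgue_nil.

Fixpoint lebesgue_rV n : {sigma_finite_measure set 'rV[R]_n -> \bar R} :=
  if n is n'.+1 then lebesgue_cons (lebesgue_rV n') else lebesgue_nil.

End lebesgue_rV.

Section box.
Context {R : realType} {n : nat}.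
Implicit Types a b : 'rV[R]_n.

Definition box a b : set 'rV[R]_n :=
  [set x | forall j, a ord0 j <= x ord0 j <= b ord0 j].

Definition open_box a b : set 'rV[R]_n :=
  [set x | forall j, a ord0 j < x ord0 j < b ord0 j].

End box.

Lemma lebesgue_rV_box (R : realType) n (a b : 'rV[R]_n) :
  (forall j, a ord0 j <= b ord0 j) ->
  lebesgue_rV n (box a b) = (\prod_j (b ord0 j - a ord0 j))%:E.
Proof.
elim: n a b => [|n IH] a b ab.
  rewrite big_ord0 /= /lebesgue_nil diracE mem_set// => -[]//.
rewrite /= (_ : box a b =
  [set x | forall j, `[a ord0 j, b ord0 j]%classic (x ord0 j)]); last first.
  by apply/seteqP; split => x /= H j; have := H j; rewrite in_itv.
have := @lebesgue_consE R n (lebesgue_rV n)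
  (fun j => `[a ord0 j, b ord0 j]%classic).
move=> ->; last by move=> j; exact: measurable_itv.
rewrite big_ord_recl EFinM; congr (_ * _)%E.
  rewrite lebesgue_measure_itv/= lte_fin EFinB.
  case: ltP => // ba; suff -> : a ord0 ord0 = b ord0 ord0 by rewrite subee.
  by apply/le_anti; rewrite ab.
pose a' := \row_j a ord0 (lift ord0 j); pose b' := \row_j b ord0 (lift ord0 j).
have := IH a' b'; rewrite (_ : box a' b' =
  [set x | forall j, `[a ord0 (lift ord0 j), b ord0 (lift ord0 j)]%classic
     (x ord0 j)]); last first.
  by apply/seteqP; split => x /= H j; have := H j; rewrite in_itv/= !mxE.
move=> ->; last by move=> j; rewrite !mxE.
by congr (_%:E); apply: eq_bigr => j _; rewrite !mxE.
Qed.

Section weak_derivative.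
Context {R : realType} {n : nat}.
Implicit Types (a b : 'rV[R]_n) (u : {set 'I_n}) (f g phi : 'rV[R]_n -> R).

Definition partial (j : 'I_n) phi : 'rV[R]_n -> R :=
  fun x => 'D_(delta_mx ord0 j) phi x.

Definition iter_partial (s : seq 'I_n) phi : 'rV[R]_n -> R :=
  foldr partial phi s.

Definition smooth phi : Prop := forall s : seq 'I_n,
  continuous (iter_partial s phi) /\
  forall j x, derivable (iter_partial s phi) x (delta_mx ord0 j).

Definition test_function a b phi : Prop :=
  [/\ smooth phi,
      compact (closure [set x | phi x != 0]) &
      closure [set x | phi x != 0] `<=` open_box a b].

(* Functions are total on R^n and extended by 0 outside the box, so that only
   their values on [a, b] matter in the L_2 and L_oo norms over [a, b]. *)
Definition L2_on a b g : Prop :=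
  (g \_ (box a b)) \in Lfun (lebesgue_rV n) 2%:E.

Definition L2norm a b g : \bar R :=
  'N[lebesgue_rV n]_2%:E[EFin \o (g \_ (box a b))].

Definition Linfnorm a b g : \bar R :=
  'N[lebesgue_rV n]_+oo[EFin \o (g \_ (box a b))].

(* g is the weak derivative D^alpha f in L_2([a, b]), where alpha is the
   indicator function of u: the multi-indices alpha in N^n with
   max_j alpha_j <= 1 are exactly the indicators of the sets u. *)
Definition is_weak_deriv a b u f g : Prop :=
  L2_on a b g /\
  forall phi, test_function a b phi ->
    \int[lebesgue_rV n]_(x in box a b) (f x * iter_partial (enum u) phi x) =
    (-1) ^+ #|u| * \int[lebesgue_rV n]_(x in box a b) (g x * phi x).

(* Unique up to a.e. equality on [a, b]; the default 0 is only met when f has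
   no weak derivative D^u f in L_2([a, b]). *)
Definition weak_deriv a b u f : 'rV[R]_n -> R :=
  xget (fun=> 0) [set g | is_weak_deriv a b u f g].

(* Elements are identified with their continuous representatives. *)
Definition H1mix a b f : Prop :=
  {within box a b, continuous f} /\
  forall u, exists g, is_weak_deriv a b u f g.

Definition H1mix_norm a b f : \bar R :=
  ((\sum_(u : {set 'I_n}) (L2norm a b (weak_deriv a b u f)) `^ 2) `^ 2^-1)%E.

Definition embedding_constant a b (C : R) : Prop :=
  forall g, H1mix a b g -> (Linfnorm a b g <= C%:E * H1mix_norm a b g)%E.

End weak_derivative.

Section anchored.
Context {R : realType} {d : nat}.
Implicit Types (a b c x : 'rV[R]_d) (u v : {set 'I_d}) (f : 'rV[R]_d -> R).

Definition downward_closed (L : {set {set 'I_d}}) : Prop :=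
  forall u v, u \in L -> v \subset u -> v \in L.

(* R^u is 'rV[R]_#|u|, its coordinates being listed by enum_val : 'I_#|u| -> u;
   restr u x is x_u, and anchor c y is (y; c)_u for y in R^u. *)
Definition restr u x : 'rV[R]_#|u| := \row_i x ord0 (enum_val i).

Definition anchor c u (y : 'rV[R]_#|u|) : 'rV[R]_d :=
  \row_j if [pick i | enum_val i == j] is Some i then y ord0 i else c ord0 j.

Lemma anchorE c u x j :
  anchor c (restr u x) ord0 j = if j \in u then x ord0 j else c ord0 j.
Proof.
rewrite mxE; case: pickP => [i /eqP <-|noi]; first by rewrite mxE enum_valP.
case: ifPn => // ju; have := noi (enum_rank_in ju j).
by rewrite enum_rankK_in// eqxx.
Qed.

(* f_{u;c}(x_u), seen as a function of x. *)
Definition anchored_component c f u x : R :=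
  \sum_(v : {set 'I_d} | v \subset u)
    (-1) ^+ (#|u| - #|v|) * f (anchor c (restr v x)).

Definition anchored_sum c f (L : {set {set 'I_d}}) x : R :=
  \sum_(u in L) anchored_component c f u x.

(* The norm of D^u f((.; c)_u) in L_2([a_u, b_u]): the weak derivative, in all
   the variables, of the section of f on [a_u, b_u]. *)
Definition face_norm a b c f u : \bar R :=
  if u == finset.set0 then `|f c|%:E
  else L2norm (restr u a) (restr u b)
         (weak_deriv (restr u a) (restr u b) (finset.setT)
           (fun y => f (anchor c y))).

Definition anchored_norm a b c (gamma : {set 'I_d} -> R) f : \bar R :=
  ((\sum_(u : {set 'I_d}) (gamma u)^-1%:E * (face_norm a b c f u) `^ 2)
    `^ 2^-1)%E.

Definition Ktilde a b u : R :=
  (\prod_(j in ~: u) (b ord0 j - a ord0 j)) `^ 2^-1 * 2 `^ (#|u|%:R / 2) *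
  \prod_(j in u) (b ord0 j - a ord0 j).

End anchored.

(* Main.v *)
Require Import Defs.
From mathcomp Require Import all_boot all_order all_algebra.
From mathcomp Require Import all_classical all_reals all_analysis.
From mathcomp Require Import measurable_realfun ess_sup_inf.
From mathcomp Require Import ring lra.

(** The anchored components sum up to f, by inclusion-exclusion over subsets
    ([anchored_decomposition]), so the error f - f_Lambda is the sum of the
    components f_{u;c} with u outside Lambda ([anchored_error]), and it is
    enough to bound each of them uniformly.

    Up to sign, f_{u;c}(x_u) is the alternating sum of the section
    h = f((.;c)_u) over the vertices of the box spanned by c_u and x_u, that
    is, the integral of D^u h over this box.  Cauchy-Schwarz then gives
      |f_{u;c}| <= (prod_{j in u} (b_j - a_j))^{1/2} ||D^u h||_{L_2}
    ([vertex_bound], [component_bound]), and gamma_u^{-1/2} ||D^u h|| is at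
    most the weighted norm of f.  The constant C_emb enters through a lower
    bound: the function 1 shows that 1 <= C_emb (prod_j (b_j - a_j))^{1/2}
    ([embedding_constant_ge]).  With V_A = prod_{j in A} (b_j - a_j) it yields
      V_u^{1/2} <= C_emb V_{~u}^{1/2} V_u <= C_emb Ktilde_u,
    whatever the lengths of the sides.  When these are at most 1, Ktilde_u is
    at most 2^{#u/2}, which is the second bound.

    Three facts on weak derivatives support this sketch.

    The vertex formula for a weak derivative w of h ([vertex_bound]).  Let
    sigma_k^p be smooth functions on the line that increase from 0 near a_j to
    1 near b_j, with a derivative that concentrates at p as k grows.  The test
    functions prod_j (sigma_k^{p_j} - sigma_k^{q_j})(x_j) are bounded by 1, and
    integrating their mixed derivative against h tends to the alternating sum
    of h over the vertices of the box spanned by p and q ([mollify]).  The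
    jumps stay inside the open interval even if p_j is one of its ends
    ([jump]), so that vertices on the boundary of the box are covered.

    The section h has a weak derivative in L_2 ([face_deriv_weak]); otherwise
    its norm would be that of a default value.  On one interval, an absolutely
    continuous g with derivative g' satisfies
      g(c) = int (rho g + K g'),   K(t) = int_a^t rho - 1_{t > c},
    for a smooth rho of integral 1.  The product of these formulas over the
    variables frozen at c expresses the restriction to the face as an integral,
    over the frozen variables, of derivatives of f, and this expression makes
    sense in L_2 after one applies D^u.

    A weak derivative is determined almost everywhere ([weak_deriv_unique]),
    so that norms which are defined through a choice of one, such as those of
    the function 1, can be computed.  The indicator of a box is a limit of
    products of jumps, and such boxes generate the Borel sets. *)

Set Implicit Arguments.
Unset Strict Implicit.
Unset Printing Implicit Defensive.

Import Order.TTheory GRing.Theory Num.Theory.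
Import numFieldNormedType.Exports.

Local Open Scope classical_set_scope.
Local Open Scope ring_scope.

(** * Sums over subsets and limits *)

(** This expansion turns products of differences into alternating sums, over
    vertices of a box as well as over sets of differentiated variables. *)
Lemma prodrB_subsets (R : comRingType) (I : finType) (F G : I -> R) :
  \prod_i (F i - G i) =
  \sum_(J : {set I}) (-1) ^+ #|J| * \prod_i (if i \in J then G i else F i).
Proof.
under eq_bigr do rewrite addrC.
rewrite bigA_distr/=; apply: eq_big => [J|J _]; first by rewrite inE.
rewrite -prodr_const [X in _ = X * _]big_mkcond -big_split/=; apply: eq_bigr => i _.
by case: ifP => _; rewrite ?mulN1r ?mul1r.
Qed.

Lemma prodrB_subsets_in (R : comRingType) (I : finType) (A : {set I}) (F G : I -> R) :
  \prod_(i in A) (F i - G i) =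
  \sum_(J : {set I} | J \subset A)
    (-1) ^+ #|J| * \prod_(i in A) (if i \in J then G i else F i).
Proof.
rewrite big_mkcond/=.
rewrite (eq_bigr (fun i => (if i \in A then F i else 1) -
    (if i \in A then G i else 0))); last first.
  by move=> i _; case: ifP; rewrite ?subr0.
rewrite prodrB_subsets [RHS]big_mkcond; apply: eq_bigr => J _.
case: ifPn => [/fintype.subsetP JA|/fintype.subsetPn[i iJ iA]].
  congr (_ * _); rewrite [RHS]big_mkcond; apply: eq_bigr => i _.
  by have := JA i; case: (i \in J); case: (i \in A) => // /(_ isT).
by rewrite (bigD1 i)//= iJ (negbTE iA) mul0r mulr0.
Qed.

Lemma signr_subn (R : comRingType) (m k : nat) : (k <= m)%N ->
  (-1) ^+ (m - k) = (-1) ^+ m * (-1) ^+ k :> R.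
Proof.
move=> km; rewrite -{2}(subnK km) exprD -mulrA -exprD addnn -mul2n exprM.
by rewrite sqrrN !expr1n mulr1.
Qed.

Lemma cvg_sumr (R : realType) (I : Type) (r : seq I) (P : pred I) (f : I -> nat -> R) (l : I -> R) :
  (forall i, P i -> f i k @[k --> \oo] --> l i) ->
  \sum_(i <- r | P i) f i k @[k --> \oo] --> \sum_(i <- r | P i) l i.
Proof.
move=> fl; elim: r => [|i r IH].
  by under eq_fun do rewrite big_nil; rewrite big_nil; exact: cvg_cst.
under eq_fun do rewrite big_cons; rewrite big_cons.
case Pi : (P i) => //; apply: cvgD => //; exact: fl.
Qed.

Lemma cvg_prodr (R : realType) (I : Type) (r : seq I) (P : pred I)
    (f : I -> nat -> R) (l : I -> R) :
  (forall i, P i -> f i k @[k --> \oo] --> l i) ->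
  \prod_(i <- r | P i) f i k @[k --> \oo] --> \prod_(i <- r | P i) l i.
Proof.
move=> fl; elim: r => [|i r IH].
  by under eq_fun do rewrite big_nil; rewrite big_nil; exact: cvg_cst.
under eq_fun do rewrite big_cons; rewrite big_cons.
case Pi : (P i) => //; apply: cvgM => //; exact: fl.
Qed.

Lemma cvg_norm_le (R : realType) (x : nat -> R) (l M : R) :
  (forall k, `|x k| <= M) -> x k @[k --> \oo] --> l -> `|l| <= M.
Proof.
move=> xM xl.
apply: (@closed_cvg _ _ _ _ _ (fun y : R => `|y| <= M) _ _ _ xl) => //.
- apply: (@closed_comp _ _ (fun y : R => `|y|) [set y | y <= M]).
    by move=> y _; exact: norm_continuous.
  exact: closed_le.
- exact: nearW.
Qed.

(** * Lebesgue measure and splittings of the coordinates *)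

Section rectangles.
Context {R : realType}.

Definition rect n (A : 'I_n -> set (measurableTypeR R)) : set 'rV[R]_n :=
  [set x | forall j, A j (x ord0 j)].

Lemma rectE n (A : 'I_n -> set (measurableTypeR R)) :
  rect A = \bigcap_j ((fun x : 'rV[R]_n => x ord0 j) @^-1` A j).
Proof. by apply/seteqP; split => x /= => [H j _|H j]; exact: H. Qed.

Lemma measurable_rect n (A : 'I_n -> set (measurableTypeR R)) :
  (forall j, measurable (A j)) -> measurable (rect A).
Proof.
move=> mA; rewrite rectE; apply: fin_bigcap_measurable => // j _.
rewrite -[X in measurable X]setTI.
exact: (measurable_coord j measurableT (mA _)).
Qed.

Lemma lebesgue_rV_rect n (A : 'I_n -> set (measurableTypeR R)) :
  (forall j, measurable (A j)) ->
  lebesgue_rV n (rect A) = (\prod_j lebesgue_measure (A j))%E.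
Proof.
elim: n A => [|n IH] A mA.
  by rewrite big_ord0 /= /lebesgue_nil diracE mem_set// => -[].
by rewrite /= lebesgue_consE// big_ord_recl -(IH (fun j => A (lift ord0 j))).
Qed.

Definition rects n : set (set 'rV[R]_n) :=
  [set X | exists2 A : 'I_n -> set (measurableTypeR R),
     (forall j, measurable (A j)) & X = rect A].

Lemma rects_setI n : setI_closed (@rects n).
Proof.
move=> _ _ [A mA ->] [B mB ->]; exists (fun j => A j `&` B j).
  by move=> j; exact: measurableI.
apply/seteqP; split => x /= => [[Ax Bx] j|H]; first by split.
by split => j; have [] := H j.
Qed.

Lemma measurable_rects n : @measurable _ 'rV[R]_n = <<s @rects n >>.
Proof.
apply/seteqP; split; last first.
  apply: smallest_sub; first exact: sigma_algebra_measurable.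
  by move=> _ [A mA ->]; exact: measurable_rect.
apply: smallest_sub; first exact: smallest_sigma_algebra.
move=> X; rewrite -bigcup_seq => -[j _ [Y mY <-]].
apply: sub_sigma_algebra; exists (fun i => if i == j then Y else setT).
  by move=> i; case: ifP.
rewrite setTI; apply/seteqP; split => x /= => [Yx i|/(_ j)].
  by case: eqP => [->|].
by rewrite eqxx.
Qed.

(** [lebesgue_rV] is built by peeling off the first coordinate. Since it is
    determined by its values on rectangles, any other way of grouping the
    coordinates gives the same measure. *)
Lemma lebesgue_rV_unique n (mu : {measure set 'rV[R]_n -> \bar R}) :
  (forall A : 'I_n -> set (measurableTypeR R), (forall j, measurable (A j)) ->
    mu (rect A) = (\prod_j lebesgue_measure (A j))%E) ->
  forall X, measurable X -> mu X = lebesgue_rV n X.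
Proof.
move=> muE; pose I k : set (measurableTypeR R) := `[- k%:R, k%:R]%classic.
have rectI k : (\prod_(j < n) lebesgue_measure (I k) < +oo)%E.
  have Ik : (lebesgue_measure (I k) < +oo)%E.
    by rewrite lebesgue_measure_itv; case: ifP; rewrite ?ltry.
  apply: (@proj2 (0 <= \prod_(j < n) lebesgue_measure (I k))%E).
  elim/big_ind: _ => [|x y [x0 xoo] [y0 yoo]|//].
    by split; [exact: lee01|rewrite ltry].
  split; first exact: mule_ge0.
  by rewrite lte_mul_pinfty// ge0_fin_numE.
apply: (measure_unique (@rects n) (fun k => rect (fun=> I k))).
- exact: measurable_rects.
- exact: rects_setI.
- by move=> k; exists (fun=> I k) => // j; exact: measurable_itv.
- rewrite -subTset => x _.
  (* Any bound of all coordinates will do; the sum of the absolute values is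
     one. *)
  pose k := Num.truncn (\sum_j `|x ord0 j|).
  exists k.+1 => // j; rewrite /I /= in_itv /= -ler_norml.
  apply: (@le_trans _ _ (\sum_j `|x ord0 j|)); last first.
    exact/ltW/truncnS_gt.
  by rewrite (bigD1 j)//= lerDl sumr_ge0.
- by move=> _ [A mA ->]; rewrite muE//; exact/esym/lebesgue_rV_rect.
- by move=> k; rewrite muE// => j; exact: measurable_itv.
Qed.

End rectangles.

Section split.
Context {R : realType} (n : nat).
Context d1 d2 (T1 : measurableType d1) (T2 : measurableType d2).
Variables (m1 : {sigma_finite_measure set T1 -> \bar R})
          (m2 : {sigma_finite_measure set T2 -> \bar R}).

(** A measurable parametrization of R^n by a product of two measure spaces,
    along which Fubini's theorem may be applied. *)
Definition is_split (G : T1 * T2 -> 'rV[R]_n) : Prop :=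
  measurable_fun setT G /\ forall X : set 'rV[R]_n, measurable X ->
    (m1 \x m2)%E (G @^-1` X) = lebesgue_rV n X.

Lemma is_split_rect (G : T1 * T2 -> 'rV[R]_n) :
  measurable_fun setT G ->
  (forall A : 'I_n -> set (measurableTypeR R), (forall j, measurable (A j)) ->
    (m1 \x m2)%E (G @^-1` rect A) = (\prod_j lebesgue_measure (A j))%E) ->
  is_split G.
Proof.
move=> mG GE; split => // X mX.
pose mu : {measure set 'rV[R]_n -> \bar R} :=
  measure_function_pushforward__canonical__measure_function_Measure
    (m1 \x m2)%E mG.
exact: (@lebesgue_rV_unique _ _ mu).
Qed.

Variables (G : T1 * T2 -> 'rV[R]_n) (Gs : is_split G).

Lemma split_tonelli (F : 'rV[R]_n -> \bar R) :
  measurable_fun setT F -> (forall x, (0 <= F x)%E) ->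
  (\int[lebesgue_rV n]_x F x = \int[m1]_x \int[m2]_y F (G (x, y)))%E.
Proof.
case: Gs => mG GE mF F0.
rewrite -(fubini_tonelli1 (fun p => F (G p)))//=; last exact: measurableT_comp.
rewrite -[RHS](ge0_integral_pushforward mG _ measurableT mF)//.
by apply: eq_measure_integral => X mX _; apply/esym; exact: GE.
Qed.

Lemma split_integrable (F : 'rV[R]_n -> R) :
  (lebesgue_rV n).-integrable setT (EFin \o F) ->
  (m1 \x m2)%E.-integrable setT (fun p => (F (G p))%:E).
Proof.
case: (Gs) => mG GE /integrableP[mF Foo]; apply/integrableP; split.
  exact: (measurableT_comp mF mG).
have mFG : measurable_fun setT (fun p => `|(F (G p))%:E|%E).
  apply: measurableT_comp => //; exact: (measurableT_comp mF mG).
rewrite (fubini_tonelli1 (fun p => `|(F (G p))%:E|%E))//.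
rewrite -(@split_tonelli (fun x => `|(F x)%:E|%E))//.
exact: measurableT_comp.
Qed.

Lemma split_fubini (F : 'rV[R]_n -> R) :
  (lebesgue_rV n).-integrable setT (EFin \o F) ->
  [/\ {ae m1, forall x, m2.-integrable setT (fun y => (F (G (x, y)))%:E)},
      m1.-integrable setT (fun x => (\int[m2]_y F (G (x, y)))%:E) &
      \int[lebesgue_rV n]_x F x = \int[m1]_x \int[m2]_y F (G (x, y))].
Proof.
move=> iF; have iFG := split_integrable iF.
have ae1 := ae_integrable1 iFG.
have iFF := integrable_fubini_F iFG.
have mF' : measurable_fun setT (fun x => (\int[m2]_y F (G (x, y)))%:E).
  apply/measurable_EFinP; apply: measurableT_comp => //.
  exact: (measurable_int _ iFF).
have aeE : ae_eq m1 setT (fun x => \int[m2]_y (F (G (x, y)))%:E)%E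
             (fun x => (\int[m2]_y F (G (x, y)))%:E).
  apply: filterS ae1 => x ix _; rewrite /Rintegral fineK//.
  exact: integrable_fin_num.
split => //.
  have /integrableP[mFF FFoo] := iFF.
  apply/integrableP; split => //; apply: le_lt_trans FFoo.
  rewrite le_eqVlt; apply/orP; left; apply/eqP.
  apply: ae_eq_integral => //; do ?exact: measurableT_comp.
  by apply: filterS aeE => x /(_ I) + _ => <-.
case: (Gs) => mG GE.
rewrite /Rintegral; congr fine.
rewrite -(ae_eq_integral _ _ _ _ _ aeE)//; last exact: (measurable_int _ iFF).
have -> := integral12_prod_meas1 iFG.
have mF : measurable_fun setT (EFin \o F) by case/integrableP : iF.
rewrite -[RHS](@integral_pushforward _ _ _ _ R G mG (m1 \x m2)%E setT
  (EFin \o F))//.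
by apply: eq_measure_integral => X mX _; apply/esym; exact: GE.
Qed.

End split.

Section splits.
Context {R : realType}.

Lemma split_rV_cons n :
  is_split (@lebesgue_measure R) (lebesgue_rV n) (@rV_cons R n).
Proof. by split => //; exact: measurable_rV_cons. Qed.

Definition rV_insert n (j : 'I_n.+1) (p : 'rV[R]_n * measurableTypeR R) :
    'rV[R]_n.+1 :=
  \row_i oapp (p.1 ord0) p.2 (unlift j i).

Lemma measurable_rV_insert n (j : 'I_n.+1) :
  measurable_fun setT (@rV_insert n j).
Proof.
apply: measurable_fun_rV => i; under eq_fun do rewrite mxE.
case: unliftP => [k _|_] /=; last exact: measurable_snd.
exact: (measurableT_comp (measurable_coord k) measurable_fst).
Qed.

Lemma split_rV_insert n (j : 'I_n.+1) :
  is_split (lebesgue_rV n) (@lebesgue_measure R) (rV_insert j).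
Proof.
apply: is_split_rect; first exact: measurable_rV_insert.
move=> A mA; rewrite (bigD1_ord j)//= -lebesgue_rV_rect; last by move=> ?; exact: mA.
have mA' : measurable (rect (fun i => A (lift j i))).
  by apply: measurable_rect => ?; exact: mA.
rewrite muleC -(product_measure1E _ _ mA' (mA j)).
congr (_ _); apply/seteqP; split => -[x t] /= => [H|[Ax At] i].
  split; last by have := H j; rewrite mxE unlift_none.
  by move=> i /=; have := H (lift j i); rewrite mxE liftK.
by rewrite mxE; case: unliftP => [k ->|->]; [exact: Ax|].
Qed.

Variable d : nat.
Implicit Types (u : {set 'I_d}).

Lemma anchor_in (c : 'rV[R]_d) u (y : 'rV[R]_#|u|) i :
  anchor c y ord0 (enum_val i) = y ord0 i.
Proof.
rewrite mxE; case: pickP => [k /eqP/enum_val_inj ->//|/(_ i)].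
by rewrite eqxx.
Qed.

Lemma anchor_out (c : 'rV[R]_d) u (y : 'rV[R]_#|u|) j :
  j \notin u -> anchor c y ord0 j = c ord0 j.
Proof.
move=> ju; rewrite mxE; case: pickP => // i /eqP ij.
by move: ju; rewrite -ij enum_valP.
Qed.

(** The point of R^d with coordinates y in u and z outside of u; anchoring z
    at 0 first supplies the coordinates that anchoring y leaves free. *)
Definition assemble u (p : 'rV[R]_#|u| * 'rV[R]_#|~: u|) : 'rV[R]_d :=
  anchor (anchor 0 p.2) p.1.

Lemma assemble_in u y z i : @assemble u (y, z) ord0 (enum_val i) = y ord0 i.
Proof. exact: anchor_in. Qed.

Lemma assemble_out u y z i : @assemble u (y, z) ord0 (enum_val i) = z ord0 i.
Proof.
rewrite /assemble anchor_out ?anchor_in//.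
by have := enum_valP i; rewrite inE.
Qed.

(** Every index of the coordinates is listed once by [enum_val], either for u
    or for its complement. *)
Lemma forall_setC u (P : 'I_d -> Prop) :
  (forall i : 'I_#|u|, P (enum_val i)) ->
  (forall i : 'I_#|~: u|, P (enum_val i)) -> forall j, P j.
Proof.
move=> Pu Pc j; case: (boolP (j \in u)) => ju.
  by rewrite -(enum_rankK_in ju ju); exact: Pu.
have jc : j \in ~: u by rewrite inE.
by rewrite -(enum_rankK_in jc jc); exact: Pc.
Qed.

Lemma measurable_assemble u : measurable_fun setT (@assemble u).
Proof.
apply: measurable_fun_rV.
apply: (@forall_setC u) => i.
- rewrite [X in measurable_fun _ X](_ : _ =
        (fun p : 'rV[R]_#|u| * 'rV[R]_#|~: u| => p.1 ord0 i)); last first.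
    by apply/funext => -[y z]; rewrite assemble_in.
  exact: (measurableT_comp (measurable_coord i) measurable_fst).
- rewrite [X in measurable_fun _ X](_ : _ =
        (fun p : 'rV[R]_#|u| * 'rV[R]_#|~: u| => p.2 ord0 i)); last first.
    by apply/funext => -[y z]; rewrite assemble_out.
  exact: (measurableT_comp (measurable_coord i) measurable_snd).
Qed.

Lemma split_assemble u :
  is_split (lebesgue_rV #|u|) (lebesgue_rV #|~: u|) (@assemble u).
Proof.
apply: is_split_rect; first exact: measurable_assemble.
move=> A mA; rewrite (bigID (mem u))/=.
have -> : (\prod_(i | i \notin u) lebesgue_measure (A i))%E =
    lebesgue_rV #|~: u| (rect (fun i => A (enum_val i))).
  rewrite lebesgue_rV_rect// -(big_enum_val (fun i => lebesgue_measure (A i))).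
  by apply: eq_bigl => i; rewrite inE.
rewrite (big_enum_val (fun i => lebesgue_measure (A i))) -lebesgue_rV_rect//.
rewrite -product_measure1E; [|exact: measurable_rect..].
congr (_ _); apply/seteqP; split => -[y z] /= => [H|[Ay Az]].
  by split => i /=; have := H (enum_val i); rewrite (assemble_in, assemble_out).
by apply: (@forall_setC u) => i; rewrite (assemble_in, assemble_out).
Qed.

End splits.

(** * Continuous functions on boxes *)

Section continuity_on_boxes.
Context {R : realType} {n : nat}.
Implicit Types (a b x y : 'rV[R]_n) (f : 'rV[R]_n -> R).

(** The form of continuity on a box that is convenient with coordinates; the
    distance of R^n is the maximum of the distances of the coordinates. *)
Lemma within_boxP a b f : {within box a b, continuous f} <->
  forall x, box a b x -> forall e, 0 < e -> exists2 r, 0 < r &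
    forall y, box a b y -> (forall j, `|y ord0 j - x ord0 j| < r) ->
    `|f y - f x| < e.
Proof.
rewrite subspace_continuousP; split => H x xab.
- move=> e e0.
  have /cvgrPdist_lt/(_ _ e0) := H x xab.
  rewrite near_withinE => /nbhs_ballP[r /= r0 rP]; exists r => // y yab xy.
  rewrite distrC; apply: rP => //; split => // i j.
  by rewrite (ord1 i) /ball/= distrC.
- apply/cvgrPdist_lt => e e0; rewrite near_withinE.
  have [r r0 rP] := H x xab e e0.
  apply/nbhs_ballP; exists r => // y [_ xy] yab.
  rewrite distrC; apply: rP => // j.
  by have := xy ord0 j; rewrite /ball/= distrC.
Qed.

Lemma compact_box a b : compact (box a b).
Proof.
have := @rV_compact R n (fun j => `[a ord0 j, b ord0 j]%classic)
  (fun j => @segment_compact _ _ _).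
congr compact; apply/seteqP; split => x H j; have := H j;
  by rewrite /= in_itv.
Qed.

Lemma within_box_bounded a b f : {within box a b, continuous f} ->
  exists M, forall x, box a b x -> `|f x| <= M.
Proof.
move=> cf; have /compact_bounded[M [Mr MP]] :=
  continuous_compact cf (@compact_box a b).
exists (M + 1) => x xab; apply: (MP (M + 1)); first by rewrite ltrDl.
by exists x.
Qed.

Lemma measurable_box a b : measurable (box a b).
Proof.
rewrite (_ : box a b = rect (fun j => `[a ord0 j, b ord0 j]%classic)).
  by apply: measurable_rect => j; exact: measurable_itv.
by apply/seteqP; split => x H j; have := H j; rewrite /= in_itv.
Qed.

Lemma measurable_floor_eq (k : R) (z : int) : 0 < k ->
  measurable [set t : measurableTypeR R | Num.floor (k * t) = z].
Proof.
move=> k0.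
rewrite (_ : [set t | _] = `[z%:~R / k, (z + 1)%:~R / k[%classic).
  exact: measurable_itv.
apply/seteqP; split => t /=; rewrite in_itv/= ler_pdivrMr// ltr_pdivlMr//.
  by move=> <-; rewrite ![_ * k]mulrC floor_le_tmp floorD1_gt.
by rewrite [t * k]mulrC => /floor_def.
Qed.

(** The grid of mesh 1/(k+1), with the points that are left of a moved to a,
    so that a point of the box is approximated inside the box. *)
Let grid a (k : nat) (z : 'rV[int]_n) : 'rV[R]_n :=
  \row_j Num.max (a ord0 j) ((z ord0 j)%:~R / k.+1%:R).

Let floors (k : nat) x : 'rV[int]_n := \row_j Num.floor (k.+1%:R * x ord0 j).

(** The sigma-algebra is generated by the coordinates and not by the open
    sets, hence measurability has to be proved: f is the limit of its values
    at grid points, and these values depend on countably many integer vectors.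
    *)
Lemma measurable_within_box a b f : {within box a b, continuous f} ->
  measurable_fun (box a b) f.
Proof.
move=> /within_boxP cf.
apply: (@measurable_fun_cvg _ _ _ _ (fun k x => f (grid a k (floors k x)))).
- move=> k; apply: measurable_funTS => _ Y mY; rewrite setTI.
  rewrite (_ : _ @^-1` _ = \bigcup_(z in [set z | Y (f (grid a k z))])
      rect (fun j => [set t | Num.floor (k.+1%:R * t) = z ord0 j])).
    rewrite bigcup_mkcond; apply: countable_bigcupT_measurable => // z.
    case: ifP => // _; apply: measurable_rect => j.
    exact: measurable_floor_eq.
  apply/seteqP; split => x /=.
    by move=> Yx; exists (floors k x) => //= j; rewrite mxE.
  move=> [z /= Yz zx]; suff -> : floors k x = z by [].
  by apply/rowP => j; rewrite mxE zx.
- move=> x xab; apply/cvgrPdist_lt => e e0.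
  have [r r0 rP] := cf x xab e e0.
  near=> k; rewrite distrC.
  have k0 : 0 < k.+1%:R :> R by [].
  have kr : k.+1%:R^-1 < r.
    by near: k; exact: (near_infty_natSinv_lt (PosNum r0)).
  have gP j : x ord0 j - k.+1%:R^-1 < grid a k (floors k x) ord0 j <= x ord0 j.
    rewrite !mxE lt_max ge_max; have /andP[-> _]/= := xab j.
    have /andP[fl1 fl2] := floor_itv (k.+1%:R * x ord0 j).
    rewrite ler_pdivrMr// [_ * k.+1%:R]mulrC fl1 andbT; apply/orP; right.
    rewrite ltr_pdivlMr// mulrBl mulVf ?gt_eqF// ltrBlDr mulrC.
    by move: fl2; rewrite intrD.
  apply: rP => j; have /andP[g1 g2] := gP j.
    rewrite (le_trans g2) ?andbT; last by have /andP[] := xab j.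
    by rewrite mxE le_max lexx.
  by rewrite ler0_norm ?subr_le0// opprB; move: g1 kr; set q := _^-1; lra.
Unshelve. all: by end_near. Qed.

End continuity_on_boxes.

(** * Square-integrable functions and limits of integrals *)

Section measure_tools.
Context {R : realType} d (T : measurableType d).
Variable mu : {measure set T -> \bar R}.
Implicit Types (D : set T) (f g : T -> R).

Lemma Lnorm2_restrict D g :
  ('N[mu]_2%:E[EFin \o (g \_ D)])%E =
  ((\int[mu]_(x in D) (g x ^+ 2)%:E) `^ 2^-1)%E.
Proof.
rewrite unlock /Lnorm; congr (_ `^ _)%E.
rewrite [RHS]integral_mkcond; apply: eq_integral => x _.
rewrite /= !patchE; case: ifP => _.
  by rewrite ?abse_EFin ?poweR_EFin powR_mulrn// real_normK ?num_real.
by rewrite ?abse_EFin normr0 ?poweR_EFin powR0// pnatr_eq0.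
Qed.

(** Hoelder's inequality for g and the indicator of D. *)
Lemma cauchy_schwarz_restrict D g : measurable D -> measurable_fun D g ->
  (\int[mu]_(x in D) `|g x|%:E <=
   (\int[mu]_(x in D) (g x ^+ 2)%:E) `^ 2^-1 * (mu D) `^ 2^-1)%E.
Proof.
move=> mD mg.
pose one : T -> R := cst 1.
have m1 : measurable_fun setT (one \_ D).
  by apply/(measurable_restrictT _ mD); exact: measurable_cst.
have mg' : measurable_fun setT (g \_ D) by apply/(measurable_restrictT _ mD).
have := @hoelder _ _ _ mu (g \_ D) (one \_ D) 2 2 mg' m1.
rewrite [(2^-1 + 2^-1)%R](_ : _ = 1); last by lra.
move=> /(_ (ltr0n _ 2) (ltr0n _ 2) erefl).
rewrite !Lnorm2_restrict Lnorm1.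
have -> : (\int[mu]_(x in D) (one x ^+ 2)%:E = mu D)%E.
  under eq_integral do rewrite /one expr1n.
  by rewrite (integral_cst mu mD 1) mul1e.
apply: le_trans; rewrite [leLHS]integral_mkcond le_eqVlt; apply/orP; left.
apply/eqP; apply: eq_integral => x _; rewrite /= !patchE.
by case: ifP => _; rewrite ?mulr1 ?normr0 ?mulr0 ?normr0.
Qed.

Lemma Rintegral_dominated D (f_ : nat -> T -> R) f g : measurable D ->
  (forall n, measurable_fun D (f_ n)) ->
  (forall x, D x -> f_ n x @[n --> \oo] --> f x) ->
  mu.-integrable D (EFin \o g) ->
  (forall n x, D x -> `|f_ n x| <= g x) ->
  mu.-integrable D (EFin \o f) /\
  \int[mu]_(x in D) f_ n x @[n --> \oo] --> \int[mu]_(x in D) f x.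
Proof.
move=> mD mf ff ig fg.
have mf' : measurable_fun D f by exact: measurable_fun_cvg ff.
have [|||||intf _ cv] := @dominated_convergence _ _ _ mu D mD
  (fun n => EFin \o f_ n) (EFin \o f) (EFin \o g).
- by move=> n; exact/measurable_EFinP.
- exact/measurable_EFinP.
- by apply/nearW => x Dx; apply: cvg_EFin; [exact: nearW|exact: ff].
- by [].
- by apply/nearW => x n Dx; rewrite /= lee_fin fg.
split => //.
by apply: (fine_cvg _); rewrite fineK //; exact: integrable_fin_num.
Qed.

Lemma integrable_Rsum D (I : Type) (r : seq I) (P : pred I) (f : I -> T -> R) :
  measurable D -> (forall i, mu.-integrable D (EFin \o f i)) ->
  mu.-integrable D (EFin \o (fun x => \sum_(i <- r | P i) f i x)).
Proof.
move=> mD intf; elim: r => [|i r IH].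
  apply: eq_integrable (integrable0 mu D) => // x _.
  by rewrite /= big_nil.
case Pi : (P i); last first.
  by apply: eq_integrable IH => // x _; rewrite /= big_cons Pi.
apply: eq_integrable (integrableD mD (intf i) IH) => // x _.
by rewrite /= big_cons Pi EFinD.
Qed.

Lemma Rintegral_sum D (I : Type) (r : seq I) (P : pred I) (f : I -> T -> R) :
  measurable D -> (forall i, mu.-integrable D (EFin \o f i)) ->
  \int[mu]_(x in D) (\sum_(i <- r | P i) f i x) =
  \sum_(i <- r | P i) \int[mu]_(x in D) f i x.
Proof.
move=> mD intf; elim: r => [|i r IH].
  under eq_Rintegral do rewrite big_nil.
  by rewrite big_nil Rintegral_cst// mul0r.
rewrite big_cons; case Pi : (P i); last first.
  by rewrite -IH; apply: eq_Rintegral => x _; rewrite big_cons Pi.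
rewrite -IH -RintegralD//; last exact: integrable_Rsum.
by apply: eq_Rintegral => x _; rewrite big_cons Pi.
Qed.

End measure_tools.

Section box_tools.
Context {R : realType} {n : nat}.
Variables a b : 'rV[R]_n.
Hypothesis ab : forall j, a ord0 j <= b ord0 j.
Implicit Types F G g : 'rV[R]_n -> R.

Let leb := lebesgue_rV (R := R) n.

(** The functions that may multiply an element of L_2 of the box. *)
Definition mbounded F : Prop := measurable_fun (box a b) F /\
  exists M, forall x, box a b x -> `|F x| <= M.

Lemma mbounded_within F : {within box a b, continuous F} -> mbounded F.
Proof.
by move=> cF; split; [exact: measurable_within_box|exact: within_box_bounded].
Qed.

Lemma mbounded_continuous F : continuous F -> mbounded F.
Proof. by move=> cF; apply/mbounded_within/continuous_subspaceT. Qed.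

Lemma mbounded_cst k : mbounded (fun=> k).
Proof. by split; [exact: measurable_cst|exists `|k|]. Qed.

Lemma mboundedM F G : mbounded F -> mbounded G -> mbounded (fun x => F x * G x).
Proof.
move=> [mF [M FM]] [mG [N GN]]; split; first exact: measurable_funM.
by exists (M * N) => x xab; rewrite normrM ler_pM ?FM ?GN.
Qed.

Lemma mbounded_prod (I : Type) (r : seq I) (P : pred I) (F : I -> 'rV[R]_n -> R) :
  (forall i, P i -> mbounded (F i)) ->
  mbounded (fun x => \prod_(i <- r | P i) F i x).
Proof.
move=> mF; elim: r => [|i r IH].
  under [X in mbounded X]eq_fun do rewrite big_nil; exact: mbounded_cst.
under [X in mbounded X]eq_fun do rewrite big_cons.
by case Pi : (P i) => //; apply: mboundedM => //; exact: mF.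
Qed.

Lemma lebesgue_box_fin : (leb (box a b) < +oo)%E.
Proof. by rewrite lebesgue_rV_box// ltry. Qed.

Lemma mbounded_integrable F : mbounded F -> leb.-integrable (box a b) (EFin \o F).
Proof.
move=> [mF [M FM]]; apply: measurable_bounded_integrable => //.
- exact: measurable_box.
- exact: lebesgue_box_fin.
- exists M; split; first exact: num_real.
  by move=> N MN x xab; apply: (le_trans (FM _ xab)); exact: ltW.
Qed.

Lemma L2_onP g : L2_on a b g <-> measurable_fun (box a b) g /\
  (\int[leb]_(x in box a b) (g x ^+ 2)%:E < +oo)%E.
Proof.
rewrite /L2_on; have mb := measurable_box a b; split.
  rewrite inE => /andP[mg]; rewrite inE/= /finite_norm.
  move: mg; rewrite inE/= => mg.
  rewrite Lnorm2_restrict => goo; split.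
    exact/(measurable_restrictT _ mb).
  exact: (@lty_poweRy _ _ 2^-1).
move=> [mg goo]; rewrite inE; apply/andP; rewrite !inE/=; split.
  exact/(measurable_restrictT _ mb).
by rewrite /finite_norm Lnorm2_restrict poweR_lty.
Qed.

Lemma L2normE g :
  L2norm a b g = ((\int[leb]_(x in box a b) (g x ^+ 2)%:E) `^ 2^-1)%E.
Proof. exact: Lnorm2_restrict. Qed.

Lemma L2_onM F g : mbounded F -> L2_on a b g -> L2_on a b (fun x => F x * g x).
Proof.
move=> [mF [M FM]] /L2_onP[mg goo]; apply/L2_onP; split.
  exact: measurable_funM.
have mb := measurable_box a b.
apply: (@le_lt_trans _ _
  (\int[leb]_(x in box a b) ((M ^+ 2)%:E * (g x ^+ 2)%:E))%E).
  apply: ge0_le_integral => //.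
  - by move=> x _; rewrite lee_fin sqr_ge0.
  - by apply/measurable_EFinP; apply: measurable_funX; exact: measurable_funM.
  - apply/measurable_EFinP; apply: measurable_funM => //.
    exact: measurable_funX.
  - move=> x xab; rewrite -EFinM lee_fin exprMn ler_wpM2r ?sqr_ge0//.
    rewrite -real_normK ?num_real// lerXn2r ?nnegrE ?FM//.
    by rewrite (le_trans (normr_ge0 _) (FM _ xab)).
rewrite ge0_integralZl//.
- by rewrite lte_mul_pinfty ?lee_fin ?sqr_ge0.
- by apply/measurable_EFinP; exact: measurable_funX.
- by move=> x _; rewrite lee_fin sqr_ge0.
- by rewrite lee_fin sqr_ge0.
Qed.

Lemma L2_onD g h : L2_on a b g -> L2_on a b h -> L2_on a b (fun x => g x + h x).
Proof.
move=> /L2_onP[mg goo] /L2_onP[mh hoo]; apply/L2_onP; split.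
  exact: measurable_funD.
have mb := measurable_box a b.
have m2 (f : 'rV[R]_n -> R) : measurable_fun (box a b) f ->
    measurable_fun (box a b) (fun x => 2%:E * (f x ^+ 2)%:E)%E.
  move=> mf; apply/measurable_EFinP; apply: measurable_funM => //.
  exact: measurable_funX.
apply: (@le_lt_trans _ _ (\int[leb]_(x in box a b)
    (2%:E * (g x ^+ 2)%:E + 2%:E * (h x ^+ 2)%:E))%E).
  apply: ge0_le_integral => //.
  - by move=> x _; rewrite lee_fin sqr_ge0.
  - by apply/measurable_EFinP; apply: measurable_funX; exact: measurable_funD.
  - by apply: emeasurable_funD; exact: m2.
  - move=> x xab; rewrite -!EFinM -EFinD lee_fin.
    by have := sqr_ge0 (g x - h x); rewrite sqrrB (sqrrD (g x)); lra.
rewrite ge0_integralD//; do ?[exact: m2|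
  by move=> x _; rewrite -EFinM lee_fin mulr_ge0 ?sqr_ge0].
rewrite !ge0_integralZl//; do ?[
  by apply/measurable_EFinP; exact: measurable_funX|
  by move=> x _; rewrite lee_fin sqr_ge0].
by rewrite lte_add_pinfty// lte_mul_pinfty.
Qed.

Lemma L2_on_cst k : L2_on a b (fun=> k).
Proof.
apply/L2_onP; split; first exact: measurable_cst.
rewrite (integral_cst leb (measurable_box a b) (k ^+ 2)%:E).
by rewrite lte_mul_pinfty ?lee_fin ?sqr_ge0//; exact: lebesgue_box_fin.
Qed.

Lemma L2_on_sum (I : Type) (r : seq I) (P : pred I) (g : I -> 'rV[R]_n -> R) :
  (forall i, P i -> L2_on a b (g i)) ->
  L2_on a b (fun x => \sum_(i <- r | P i) g i x).
Proof.
move=> gL; elim: r => [|i r IH].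
  under [X in L2_on _ _ X]eq_fun do rewrite big_nil; exact: L2_on_cst.
under [X in L2_on _ _ X]eq_fun do rewrite big_cons.
by case Pi : (P i) => //; apply: L2_onD => //; exact: gL.
Qed.

Lemma cauchy_schwarz_box g : measurable_fun (box a b) g ->
  (\int[leb]_(x in box a b) `|g x|%:E <=
   L2norm a b g * ((\prod_j (b ord0 j - a ord0 j)) `^ 2^-1)%:E)%E.
Proof.
move=> mg; rewrite L2normE.
have := cauchy_schwarz_restrict leb (measurable_box a b) mg.
by rewrite [X in (_ * X `^ _)%E]lebesgue_rV_box.
Qed.

Lemma L2norm_fin g : L2_on a b g -> L2norm a b g \is a fin_num.
Proof.
move=> /L2_onP[mg goo]; rewrite L2normE ge0_fin_numE ?poweR_ge0//.
exact: poweR_lty.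
Qed.

Lemma L2_integrable g : L2_on a b g -> leb.-integrable (box a b) (EFin \o g).
Proof.
move=> gL; have [mg goo] := (L2_onP g).1 gL; apply/integrableP; split.
  exact/measurable_EFinP.
apply: le_lt_trans (cauchy_schwarz_box mg) _.
by rewrite lte_mul_pinfty ?ltry ?L2norm_fin// L2normE poweR_ge0.
Qed.

Lemma mboundedM_integrable F g : mbounded F -> L2_on a b g ->
  leb.-integrable (box a b) (EFin \o (fun x => F x * g x)).
Proof. by move=> mF gL; exact/L2_integrable/L2_onM. Qed.

End box_tools.

(** * Smooth steps on the line *)

Section smooth_line.
Context {R : realType}.
Implicit Types f g : R -> R.

(** Differentiability up to order k, with the derivative as a witness: Leibniz
    and chain rules then follow by induction on k, without a formula for the
    k-th derivative. *)
Fixpoint diffn k f : Prop :=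
  if k is l.+1 then
    exists2 g, (forall x : R, is_derive x (1 : R) f (g x)) & diffn l g
  else True.

Definition smooth1 f := forall k, diffn k f.

Lemma diffnW k f : diffn k.+1 f -> diffn k f.
Proof.
by elim: k f => //= k IH f [g fg gk]; exists g => //; exact: IH.
Qed.

Lemma diffnD k f g : diffn k f -> diffn k g -> diffn k (f + g).
Proof.
elim: k f g => //= k IH f g [f' ff' kf'] [g' gg' kg'].
by exists (f' + g'); [move=> x; exact: (is_deriveD (ff' x) (gg' x))|exact: IH].
Qed.

Lemma diffn_cst k (c : R) : diffn k (cst c).
Proof. by elim: k c => //= k IH c; exists (cst 0) => // x; exact: is_derive_cst. Qed.

Lemma diffnM k f g : diffn k f -> diffn k g -> diffn k (f * g).
Proof.
elim: k f g => //= k IH f g [f' ff' kf'] [g' gg' kg'].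
exists (f * g' + g * f').
  by move=> x; exact: (is_derive_eq (is_deriveM (ff' x) (gg' x))).
apply: diffnD; apply: IH => //; apply: diffnW; first by exists f'.
by exists g'.
Qed.

Lemma diffn_comp k f g : diffn k f -> diffn k g -> diffn k (f \o g).
Proof.
elim: k f g => //= k IH f g [f' ff' kf'] [g' gg' kg'].
exists ((f' \o g) * g').
  by move=> x; apply: is_derive1_comp.
by apply: diffnM => //; apply: IH => //; apply: diffnW; exists g'.
Qed.

Lemma diffn_affine k (m c : R) : diffn k (fun t => m * t + c).
Proof.
case: k => //= k; exists (cst m); last exact: diffn_cst.
move=> x; rewrite (_ : (fun _ => _) = m \*: id + cst c)//.
by apply: is_derive_eq; rewrite addr0 -mulr_algr scaler1 mul1r.
Qed.

Lemma smooth1_derive1 f : smooth1 f -> smooth1 (derive1 f).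
Proof.
move=> sf k; have [g fg gk] := sf k.+1.
rewrite (_ : (derive1 f) = g)//; apply/funext => x.
by have fgx := fg x; rewrite derive1E derive_val.
Qed.

Lemma smooth1_is_derive f : smooth1 f -> forall x, is_derive x (1 : R) f ((derive1 f) x).
Proof.
move=> sf x; have [g fg _] := sf 1%N; have fgx := fg x.
by rewrite derive1E derive_val.
Qed.

Lemma smooth1_continuous f : smooth1 f -> continuous f.
Proof.
move=> sf x; apply: differentiable_continuous; apply/derivable1_diffP.
by have [] := smooth1_is_derive sf x.
Qed.

Lemma derive1_sub f g (t : R) : derivable f t 1 -> derivable g t 1 ->
  derive1 (f - g) t = derive1 f t - derive1 g t.
Proof.
move=> df dg; rewrite !derive1E.
exact: (@deriveB R R R f g t 1 df dg).
Qed.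

Lemma smooth1D f g : smooth1 f -> smooth1 g -> smooth1 (f + g).
Proof. by move=> sf sg k; exact: diffnD. Qed.

Lemma smooth1_cst c : smooth1 (cst c).
Proof. by move=> k; exact: diffn_cst. Qed.

Lemma smooth1M f g : smooth1 f -> smooth1 g -> smooth1 (f * g).
Proof. by move=> sf sg k; exact: diffnM. Qed.

Lemma smooth1_comp f g : smooth1 f -> smooth1 g -> smooth1 (f \o g).
Proof. by move=> sf sg k; exact: diffn_comp. Qed.

Lemma smooth1_affine m c : smooth1 (fun t => m * t + c).
Proof. by move=> k; exact: diffn_affine. Qed.

(** t^-k exp(-1/t) for t > 0, extended by 0. *)
(** The functions t^-k exp(-1/t), extended by 0 for t <= 0. They are kept
    together because differentiation maps one of them to a combination of two
    others, which makes all of them smooth. *)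
Definition flat (k : nat) (t : R) : R :=
  if 0 < t then t^-1 ^+ k * expR (- t^-1) else 0.

Lemma flat_ge0 k t : 0 <= flat k t.
Proof.
rewrite /flat; case: ifPn => // t0.
by rewrite mulr_ge0 ?expR_ge0// exprn_ge0// invr_ge0 ltW.
Qed.

(** From exp(y/m) >= 1 + y/m >= y/m, raised to the power m. *)
Lemma pow_le_expR m (y : R) : 0 <= y -> y ^+ m.+1 <= m.+1%:R ^+ m.+1 * expR y.
Proof.
move=> y0; have m0 : 0 < m.+1%:R :> R by [].
have -> : y = m.+1%:R * (y / m.+1%:R) by rewrite mulrC divfK// gt_eqF.
rewrite expRM_natl exprMn ler_pM2l ?exprn_gt0//.
rewrite lerXn2r ?nnegrE ?divr_ge0 ?expR_ge0//.
by rewrite (le_trans _ (expR_ge1Dx _))// lerDr.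
Qed.

(** The quadratic bound at 0 gives the derivative 0 there. *)
Lemma flat_le k t : flat k t <= k.+2%:R ^+ k.+2 * t ^+ 2.
Proof.
rewrite /flat; case: ifPn => t0; last by rewrite mulr_ge0 ?sqr_ge0.
have := @pow_le_expR k.+1 t^-1; rewrite invr_ge0 ltW// => /(_ isT).
rewrite expRN -ler_pdivrMr ?expR_gt0// => H.
have -> : t^-1 ^+ k / expR t^-1 = (t^-1 ^+ k.+2 / expR t^-1) * t ^+ 2.
  rewrite !exprS; field; by rewrite gt_eqF ?expR_gt0//= gt_eqF.
by rewrite ler_wpM2r ?sqr_ge0.
Qed.

(** For t > 0 this is a computation; at 0 it rests on [flat_le]. *)
Lemma is_derive_flat k (t : R) :
  is_derive t (1 : R) (flat k) (flat k.+2 t - k%:R * flat k.+1 t).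
Proof.
have [t0|t0|->] := ltgtP t 0.
- rewrite /flat !ltNge (ltW t0)/= mulr0 subr0.
  apply: (near_eq_is_derive (f := cst 0)) => //.
  near=> x; rewrite /= ltNge (_ : x <= 0)//=.
  by near: x; exact: lt_le_nbhsl.
- have tN0 : t != 0 by rewrite gt_eqF.
  have dV : is_derive t (1 : R) (fun x : R => x^-1) (- t ^- 2).
    by apply: is_derive_eq (is_deriveV tN0 (is_derive_id _ _)) _; rewrite scaler1.
  have dk := is_deriveX k dV.
  have de := @is_derive1_comp R expR (- (fun x : R => x^-1)) t _ _
    (is_derive_expR _) (is_deriveN dV).
  apply: (near_eq_is_derive (f := (fun x : R => x^-1) ^+ k *
    (expR \o (- (fun x : R => x^-1))))).
    near=> x; rewrite /flat (_ : 0 < x) ?fctE//.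
    by near: x; exact: lt_nbhsr.
  apply: is_derive_eq (is_deriveM dk de) _.
  rewrite /flat t0/= !fctE /GRing.scale/=.
  case: k {dk} => [|k]; rewrite !exprS/=; field => //.
- rewrite {2 3}/flat ltxx mulr0 subr0.
  suff cv : h^-1 *: (flat k (h *: (1 : R) + 0) - flat k 0) @[h --> 0^'] --> (0 : R).
    by apply: DeriveDef; [apply/cvg_ex; exists 0|exact: cvg_lim].
  pose C : R := k.+2%:R ^+ k.+2.
  have C0 : 0 < C by rewrite exprn_gt0.
  apply/cvgrPdist_lt => e e0; near=> h.
  have hN0 : h != 0 by near: h; exact: nbhs_dnbhs_neq.
  rewrite addr0 sub0r normrN {2}/flat ltxx subr0 /GRing.scale/= mulr1 normrM.
  rewrite normfV (ger0_norm (flat_ge0 _ _)) ltr_pdivrMl ?normr_gt0//.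
  rewrite (le_lt_trans (flat_le _ _))// -/C -real_normK ?num_real//.
  rewrite expr2 mulrCA ltr_pM2l ?normr_gt0// mulrC -ltr_pdivlMr//.
  near: h; apply: dnbhs0_lt; exact: divr_gt0.
Unshelve. all: by end_near. Qed.

Lemma smooth1_flat k : smooth1 (flat k).
Proof.
move=> l; elim: l k => //= l IH k.
exists (flat k.+2 + cst (- k%:R) * flat k.+1).
  by move=> x; rewrite fctE/= mulNr; exact: is_derive_flat.
by apply: diffnD => //; apply: diffnM => //; exact: diffn_cst.
Qed.

Lemma derive1_flat0 t : derive1 (flat 0) t = flat 2 t.
Proof.
have d := is_derive_flat 0 t.
by rewrite derive1E derive_val mul0r subr0.
Qed.

Lemma flat_eq0 k t : t <= 0 -> flat k t = 0.
Proof. by rewrite /flat ltNge => ->. Qed.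

Lemma flat0_gt0 t : 0 < t -> 0 < flat 0 t.
Proof. by rewrite /flat => ->; rewrite expr0 mul1r expR_gt0. Qed.

Lemma flat0_le s t : s <= t -> flat 0 s <= flat 0 t.
Proof.
move=> st; have [s0|s0] := lerP s 0; first by rewrite flat_eq0// flat_ge0.
have t0 : 0 < t by exact: lt_le_trans st.
by rewrite /flat s0 t0 !expr0 !mul1r ler_expR lerN2 lef_pV2.
Qed.

(** A smooth step from 0 (for t <= 0) to 1 (for t >= 1). Nesting two flat
    functions gives the exact value 1 for t >= 1 by composition alone, without
    a quotient of functions. *)
Definition step (t : R) : R :=
  flat 0 (1 - flat 0 (1 - t) / flat 0 1) / flat 0 1.

Let e1_gt0 : 0 < flat 0 1. Proof. exact: flat0_gt0. Qed.

Lemma step_eq0 t : t <= 0 -> step t = 0.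
Proof.
move=> t0; rewrite /step flat_eq0 ?mul0r// subr_le0 ler_pdivlMr// mul1r.
by apply: flat0_le; rewrite lerBrDl gerDr.
Qed.

Lemma step_eq1 t : 1 <= t -> step t = 1.
Proof.
move=> t1; rewrite /step (flat_eq0 _ (t := 1 - t)) ?subr_le0//.
by rewrite mul0r subr0 divff// gt_eqF.
Qed.

Lemma step_ge0 t : 0 <= step t.
Proof. by rewrite divr_ge0 ?flat_ge0. Qed.

Lemma step_le1 t : step t <= 1.
Proof.
rewrite ler_pdivrMr// mul1r flat0_le// gerBl.
by rewrite divr_ge0 ?flat_ge0.
Qed.

Let inner (t : R) : R := - (flat 0 1)^-1 * flat 0 (-1 * t + 1) + 1.

Let stepE : step = cst (flat 0 1)^-1 * (flat 0 \o inner).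
Proof.
apply/funext => t; rewrite /step /inner !fctE/= mulrC; congr (_ * flat 0 _).
rewrite mulN1r [- t + 1]addrC; set q := _^-1; ring.
Qed.

Let smooth1_inner : smooth1 inner.
Proof.
apply: (@smooth1_comp (fun t => - (flat 0 1)^-1 * t + 1)
  (flat 0 \o (fun t => -1 * t + 1))).
  exact: smooth1_affine.
by apply: smooth1_comp; [exact: smooth1_flat|exact: smooth1_affine].
Qed.

Lemma smooth1_step : smooth1 step.
Proof.
rewrite stepE; apply: smooth1M; first exact: smooth1_cst.
by apply: smooth1_comp; first exact: smooth1_flat.
Qed.

Lemma smooth1_derivable f : smooth1 f -> forall x, derivable f x 1.
Proof. by move=> sf x; have [] := smooth1_is_derive sf x. Qed.

Lemma derive1_affine (m c t : R) : derive1 (fun t => m * t + c) t = m.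
Proof.
rewrite derive1E; have d : is_derive t (1 : R) (fun t => m * t + c) m.
  rewrite (_ : (fun _ => _) = m \*: id + cst c)//.
  by apply: is_derive_eq; rewrite addr0 -mulr_algr scaler1 mul1r.
by rewrite derive_val.
Qed.

Lemma derive1_step_ge0 t : 0 <= derive1 step t.
Proof.
have saff (m c : R) x : derivable (fun t => m * t + c) x 1.
  exact/smooth1_derivable/smooth1_affine.
have sflat k x : derivable (flat k) x 1 by exact/smooth1_derivable/smooth1_flat.
have sfa (m c : R) : smooth1 (flat 0 \o (fun t => m * t + c)).
  by apply: smooth1_comp; [exact: smooth1_flat|exact: smooth1_affine].
rewrite stepE.
have -> : cst (flat 0 1)^-1 * (flat 0 \o inner) =
  (flat 0 1)^-1 \*: (flat 0 \o inner) by [].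
rewrite derive1E deriveZ -?derive1E; last first.
  apply: smooth1_derivable; apply: smooth1_comp => //; exact: smooth1_flat.
rewrite /GRing.scale/= mulr_ge0 ?invr_ge0 ?flat_ge0//.
rewrite derive1_comp//; last exact: smooth1_derivable.
rewrite derive1_flat0 mulr_ge0 ?flat_ge0//.
rewrite (@derive1_comp _ (flat 0 \o (fun t => -1 * t + 1))
  (fun t => - (flat 0 1)^-1 * t + 1))//; last exact: smooth1_derivable.
rewrite derive1_affine derive1_comp// derive1_affine derive1_flat0.
by rewrite mulrN1 mulrNN mulr_ge0 ?invr_ge0 ?flat_ge0.
Qed.

End smooth_line.

Section jump.
Context {R : realType}.

(** Away from its transition a step is locally constant. *)
Lemma derive1_near_cst (f : R -> R) (k t : R) :
  (\near t, f t = k) -> derive1 f t = 0.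
Proof.
by move=> fk; rewrite derive1E (near_eq_derive (g := fun=> k) _ fk) derive_cst.
Qed.

Implicit Types (a b c t : R) (n : nat).

(** The slope of the k-th jump. The width b - c, or b - a if c = b, over k+3
    leaves room for three transitions, hence the jump stays inside ]a, b[ for
    every k. *)
Definition jump_rate a b c n : R :=
  n.+3%:R / (if c < b then b - c else b - a).

(** The transition happens on the right of c, except if c = b, when it happens
    on the left. This is what allows c to be an end of the interval. *)
Definition jump_start a b c n : R :=
  if c < b then c + (jump_rate a b c n)^-1 else b - 2 * (jump_rate a b c n)^-1.

Definition jump a b c n t : R :=
  step (jump_rate a b c n * t - jump_rate a b c n * jump_start a b c n).

(** The pointwise limit of the jumps. It is 0 at c, unless c = b, when it is 1
    at c. *)
Definition jump_lim a b c t : R := ((if c < b then c < t else b <= t) : bool)%:R.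

Section fixed.
Variables a b c : R.
Hypotheses (ab : a < b) (cab : a <= c <= b).

Let width : R := if c < b then b - c else b - a.

Let width_gt0 : 0 < width.
Proof. by rewrite /width; case: ifP; rewrite subr_gt0. Qed.

Lemma jump_rate_gt0 n : 0 < jump_rate a b c n.
Proof. by rewrite divr_gt0. Qed.

Let q n : R := (jump_rate a b c n)^-1.

Let qE n : q n = width / n.+3%:R.
Proof. by rewrite /q /jump_rate invf_div. Qed.

Let q_gt0 n : 0 < q n.
Proof. by rewrite invr_gt0 jump_rate_gt0. Qed.

Let q_lt n : 3 * q n <= width.
Proof.
rewrite qE mulrA ler_pdivrMr// mulrC ler_pM2l//.
by rewrite -[n.+3]addn3 natrD lerDr.
Qed.

Let q_cvg (r : R) : 0 < r -> \forall n \near \oo, 2 * q n < r.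
Proof.
move=> r0; have r' : 0 < r / (2 * width) by rewrite divr_gt0// mulr_gt0.
have := near_infty_natSinv_lt (PosNum r'); apply: filterS => n /= H.
rewrite qE mulrA mulrC -ltr_pdivlMr ?mulr_gt0//.
rewrite (le_lt_trans _ H)// lef_pV2 ?posrE// ler_nat.
by rewrite ltnS (leq_trans (leqnSn n)).
Qed.

Lemma jump_start_gt n : a < jump_start a b c n.
Proof.
rewrite /jump_start -/(q n); move: (q_lt n) (q_gt0 n) cab; rewrite /width.
by move: (q n) => Q; case: ifP => _ ? ? /andP[? ?]; lra.
Qed.

Lemma jump_stop_lt n : jump_start a b c n + q n < b.
Proof.
rewrite /jump_start -/(q n); move: (q_lt n) (q_gt0 n) cab; rewrite /width.
by move: (q n) => Q; case: ifP => _ ? ? /andP[? ?]; lra.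
Qed.

Lemma jump_start_near n : c - 2 * q n <= jump_start a b c n.
Proof.
rewrite /jump_start -/(q n); move: (q_lt n) (q_gt0 n) cab; rewrite /width.
by move: (q n) => Q; case: ifP => _ ? ? /andP[? ?]; lra.
Qed.

Lemma jump_stop_near n : jump_start a b c n + q n <= c + 2 * q n.
Proof.
rewrite /jump_start -/(q n); move: (q_lt n) (q_gt0 n) cab; rewrite /width.
move: (q n) => Q; case: ltP => cb ? ? /andP[? cb']; first lra.
by have -> : c = b by [apply/le_anti/andP]; lra.
Qed.

Lemma jump_eq0 n t : t <= jump_start a b c n -> jump a b c n t = 0.
Proof.
move=> tp; rewrite /jump step_eq0// subr_le0 ler_pM2l//; exact: jump_rate_gt0.
Qed.

Lemma jump_eq1 n t : jump_start a b c n + q n <= t -> jump a b c n t = 1.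
Proof.
move=> tp; rewrite /jump step_eq1// -mulrBr -ler_pdivrMl ?jump_rate_gt0//.
by rewrite mulr1 lerBrDl.
Qed.

Lemma jump_ge0 n t : 0 <= jump a b c n t. Proof. exact: step_ge0. Qed.

Lemma jump_le1 n t : jump a b c n t <= 1. Proof. exact: step_le1. Qed.

Lemma smooth1_jump n : smooth1 (jump a b c n).
Proof.
apply: (@smooth1_comp _ step (fun t => jump_rate a b c n * t +
  - (jump_rate a b c n * jump_start a b c n))).
  exact: smooth1_step.
exact: smooth1_affine.
Qed.

Lemma derive1_jump_ge0 n t : 0 <= derive1 (jump a b c n) t.
Proof.
rewrite (_ : jump a b c n = step \o (fun t => jump_rate a b c n * t +
  - (jump_rate a b c n * jump_start a b c n)))//.
rewrite derive1_comp.
- rewrite derive1_affine mulr_ge0 ?derive1_step_ge0//.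
  exact/ltW/jump_rate_gt0.
- exact/smooth1_derivable/smooth1_affine.
- exact/smooth1_derivable/smooth1_step.
Qed.

(** The mass of the derivative, which is 1, concentrates at c. *)
Lemma derive1_jump_eq0 (r : R) : 0 < r -> \forall n \near \oo, forall t,
  r <= `|t - c| -> derive1 (jump a b c n) t = 0.
Proof.
move=> r0; apply: filterS (q_cvg r0) => n qr t.
rewrite ler_normr => /orP[rt|rt].
  apply: (@derive1_near_cst _ 1).
  have : jump_start a b c n + q n < t.
    by have := jump_stop_near n; lra.
  move=> /lt_nbhsr; apply: filterS => x H.
  by rewrite jump_eq1// ltW.
apply: (@derive1_near_cst _ 0).
have : t < jump_start a b c n by have := jump_start_near n; lra.
move=> /lt_nbhsl; apply: filterS => x H.
by rewrite jump_eq0// ltW.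
Qed.

Lemma jump_cvg t : jump a b c n t @[n --> \oo] --> jump_lim a b c t.
Proof.
rewrite /jump_lim; have [cb|bc] := ltP c b; last first.
  have bc' : c = b by apply/le_anti; rewrite bc andbT; case/andP: cab.
  case: leP => bt.
    apply: cvg_near_cst; apply: nearW => n; rewrite jump_eq1//.
    by rewrite (le_trans _ bt)// ltW// jump_stop_lt.
  have bt' : 0 < b - t by rewrite subr_gt0.
  apply: cvg_near_cst; apply: filterS (q_cvg bt') => n qr.
  by rewrite jump_eq0//; have := jump_start_near n; rewrite bc'; lra.
case: ltP => ct.
  have ct' : 0 < t - c by rewrite subr_gt0.
  apply: cvg_near_cst; apply: filterS (q_cvg ct') => n qr.
  by rewrite jump_eq1//; have := jump_stop_near n; lra.
apply: cvg_near_cst; apply: nearW => n; rewrite jump_eq0//.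
rewrite /jump_start cb -/(q n); have := q_gt0 n; lra.
Qed.

(** Hence a difference of two jumps, and the derivative of a jump, have
    compact support in ]a, b[. *)
Lemma jump_margin n : exists2 r, 0 < r &
  (forall t, t <= a + r -> jump a b c n t = 0) /\
  (forall t, b - r <= t -> jump a b c n t = 1).
Proof.
pose s := jump_start a b c n.
exists (Num.min (s - a) (b - (s + q n))).
  by rewrite lt_min !subr_gt0 jump_start_gt jump_stop_lt.
split => t H.
  apply: jump_eq0; rewrite (le_trans H)// -lerBrDl ge_min.
  by rewrite lexx.
apply: jump_eq1; rewrite (le_trans _ H)// lerBrDl -lerBrDr ge_min.
by rewrite lexx orbT.
Qed.

End fixed.

End jump.

(** * Product test functions *)

Section product_functions.
Context {R : realType} {d : nat} (u : {set 'I_d}).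
Implicit Types (x : 'rV[R]_d) (phi : 'rV[R]_#|u| -> R) (chi : 'I_d -> R -> R).

(** A function of the coordinates in u times functions of the single
    coordinates outside of u: a test function on a face is extended in this
    way to a test function on the box. *)
Definition prodfun phi chi x : R :=
  phi (restr u x) * \prod_(j | j \notin u) chi j (x ord0 j).

Lemma restr_continuous : continuous (@restr R d u).
Proof.
move=> x A /nbhs_ballP[e /= e0 eA]; apply/nbhs_ballP; exists e => //= y [_ xy].
by apply: eA; split => // i j; rewrite !mxE; exact: xy.
Qed.

Lemma prodfun_continuous phi chi :
  continuous phi -> (forall j, continuous (chi j)) -> continuous (prodfun phi chi).
Proof.
move=> cphi cchi.
have cP s : continuous (fun y : 'rV[R]_d =>
    \prod_(j <- s | j \notin u) chi j (y ord0 j)).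
  elim: s => [|j s IH].
    have -> : (fun y : 'rV[R]_d =>
        \prod_(j <- [::] | j \notin u) chi j (y ord0 j)) = cst 1.
      by apply/funext => y; rewrite big_nil.
    exact: cst_continuous.
  pose F := (fun y : 'rV[R]_d => (if j \notin u then chi j (y ord0 j) else 1) *
    \prod_(j <- s | j \notin u) chi j (y ord0 j)).
  have -> : (fun y : 'rV[R]_d =>
      \prod_(j <- j :: s | j \notin u) chi j (y ord0 j)) = F.
    by apply/funext => y; rewrite /F big_cons; case: ifP; rewrite ?mul1r.
  move=> x; apply: continuousM; last exact: IH.
  case: (j \notin u); last exact: cst_continuous.
  apply: (@continuous_comp _ _ _ (fun y : 'rV[R]_d => y ord0 j) (chi j)).
    exact: coord_continuous.
  exact: cchi.
move=> x; apply: (@continuousM _ _ (fun x => phi (restr u x))); last exact: cP.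
apply: (@continuous_comp _ _ _ (@restr R d u) phi); last exact: cphi.
exact: restr_continuous.
Qed.

(** The difference quotient is that of phi times a constant. *)
Lemma prodfun_derive_in phi chi x i :
  derivable phi (restr u x) (delta_mx ord0 i) ->
  is_derive x (delta_mx ord0 (enum_val i)) (prodfun phi chi)
    (prodfun (partial i phi) chi x).
Proof.
move=> dphi.
suff cv : h^-1 *: ((prodfun phi chi \o shift x) (h *: delta_mx ord0 (enum_val i))
     - prodfun phi chi x) @[h --> 0^'] --> prodfun (partial i phi) chi x.
  by apply: DeriveDef; [apply/cvg_ex; eexists; exact: cv|exact: cvg_lim].
set P := \prod_(j | j \notin u) chi j (x ord0 j).
rewrite (_ : (fun _ => _) = fun h => h^-1 *:
   ((phi \o shift (restr u x)) (h *: delta_mx ord0 i) - phi (restr u x)) * P).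
  by apply: cvgMr_tmp; exact: dphi.
apply/funext => h; rewrite /prodfun -/P/=.
have -> : restr u (h *: delta_mx ord0 (enum_val i) + x) =
    h *: delta_mx ord0 i + restr u x.
  by apply/rowP => k; rewrite !mxE !eqxx/= (inj_eq enum_val_inj).
rewrite (eq_bigr (fun j => chi j (x ord0 j))).
  by rewrite -/P -mulrBl scalerAl.
move=> j ju; rewrite !mxE (_ : j == enum_val i = false) ?andbF ?mulr0 ?add0r//.
by apply/negbTE/eqP => ij; move: ju; rewrite ij enum_valP.
Qed.

(** The difference quotient is that of one factor times a constant. *)
Lemma prodfun_derive_out phi chi x j : j \notin u ->
  derivable (chi j) (x ord0 j) 1 ->
  is_derive x (delta_mx ord0 j) (prodfun phi chi)
    (prodfun phi (fun k => if k == j then derive1 (chi k) else chi k) x).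
Proof.
move=> ju dchi; set chi' : 'I_d -> R -> R := fun k => _.
suff cv : h^-1 *: ((prodfun phi chi \o shift x) (h *: delta_mx ord0 j)
     - prodfun phi chi x) @[h --> 0^'] --> prodfun phi chi' x.
  by apply: DeriveDef; [apply/cvg_ex; eexists; exact: cv|exact: cvg_lim].
pose P := \prod_(k | (k \notin u) && (k != j)) chi k (x ord0 k).
rewrite (_ : (fun _ => _) = fun h => (phi (restr u x) * P) * (h^-1 *:
   ((chi j \o shift (x ord0 j)) (h *: 1) - chi j (x ord0 j)))).
  rewrite /prodfun (bigD1 j)//= /chi' eqxx (eq_bigr (fun k => chi k (x ord0 k))).
    rewrite -/P derive1E [X in _ --> phi _ * X]mulrC mulrA.
    apply: cvgMl_tmp; exact: dchi.
  by move=> k /andP[_ /negbTE ->].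
apply/funext => h; rewrite /prodfun /=.
have -> : restr u (h *: delta_mx ord0 j + x) = restr u x.
  apply/rowP => k; rewrite !mxE (_ : _ == j = false) ?andbF ?mulr0 ?add0r//.
  by apply/negbTE/eqP => ij; move: ju; rewrite -ij enum_valP.
rewrite (bigD1 j)//= [in X in _ - X](bigD1 j)//= !mxE !eqxx.
rewrite (eq_bigr (fun k => chi k (x ord0 k))).
  by rewrite -/P /GRing.scale/=; ring.
by move=> k /andP[_ kj]; rewrite !mxE (negbTE kj) andbF mulr0 add0r.
Qed.

(** The inverse of [enum_val], defined on all indices. *)
Definition index_in (j : 'I_d) : option 'I_#|u| := [pick i | enum_val i == j].

Lemma index_in_enum_val i : index_in (enum_val i) = Some i.
Proof.
rewrite /index_in; case: pickP => [k /eqP/enum_val_inj -> //|/(_ i)].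
by rewrite eqxx.
Qed.

Variant index_in_spec j : option 'I_#|u| -> Type :=
| IndexIn i of j = enum_val i : index_in_spec j (Some i)
| IndexOut of j \notin u : index_in_spec j None.

Lemma index_inP j : index_in_spec j (index_in j).
Proof.
case: (boolP (j \in u)) => ju.
  rewrite -(enum_rankK_in ju ju) index_in_enum_val.
  by apply: IndexIn; rewrite enum_rankK_in.
rewrite /index_in; case: pickP => [i /eqP ij|_]; last exact: IndexOut.
by move: ju; rewrite -ij enum_valP.
Qed.

Lemma smooth1_derive1n k (h : R -> R) : smooth1 h -> smooth1 (derive1n k h).
Proof. by move=> sh; elim: k => //= k IH; exact: smooth1_derive1. Qed.

Lemma derivable_derive1n k (h : R -> R) : smooth1 h ->
  forall t, derivable (derive1n k h) t 1.
Proof. by move=> sh; exact/smooth1_derivable/smooth1_derive1n. Qed.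

Arguments derivable_derive1n : clear implicits.

Lemma eq_prodfun phi chi chi' : (forall j, j \notin u -> chi j = chi' j) ->
  prodfun phi chi = prodfun phi chi'.
Proof.
move=> e; apply/funext => x; congr (_ * _).
by apply: eq_bigr => j ju; rewrite e.
Qed.

Lemma iter_partial_prodfun s phi chi :
  smooth phi -> (forall j, smooth1 (chi j)) ->
  iter_partial s (prodfun phi chi) =
  prodfun (iter_partial (pmap index_in s) phi)
    (fun j => derive1n (count_mem j s) (chi j)).
Proof.
move=> sphi schi; elim: s => //= j s ->.
case: index_inP => [i ->|ju] /=.
  apply/funext => x; rewrite /partial.
  have dd := prodfun_derive_in (fun k => derive1n (count_mem k s) (chi k))
     ((sphi (pmap index_in s)).2 i (restr u x)).
  rewrite derive_val; congr (_ x); apply: eq_prodfun => k ku.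
  suff -> : enum_val i == k = false by [].
  by apply/negbTE/eqP => ik; move: ku; rewrite -ik enum_valP.
apply/funext => x; rewrite /partial.
have dd := @prodfun_derive_out (iter_partial (pmap index_in s) phi)
  (fun k => derive1n (count_mem k s) (chi k)) x j ju
  (derivable_derive1n _ _ (schi j) _).
rewrite derive_val; congr (_ x); apply: eq_prodfun => k ku.
have [->|kj] := eqVneq k j; last by [].
by rewrite add1n.
Qed.

Lemma smooth_prodfun phi chi :
  smooth phi -> (forall j, smooth1 (chi j)) -> smooth (prodfun phi chi).
Proof.
move=> sphi schi s; rewrite iter_partial_prodfun//; split.
  apply: prodfun_continuous; first exact: (sphi _).1.
  by move=> j; exact/smooth1_continuous/smooth1_derive1n.
move=> j x; case: (index_inP j) => [i ->|ju].
  by have [] := prodfun_derive_in (fun k => derive1n (count_mem k s) (chi k))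
     ((sphi (pmap index_in s)).2 i (restr u x)).
by have [] := @prodfun_derive_out (iter_partial (pmap index_in s) phi)
  (fun k => derive1n (count_mem k s) (chi k)) x j ju
  (derivable_derive1n _ _ (schi j) _).
Qed.

(** Both enumerations are increasing, hence the partial derivatives in the
    variables of u are taken in the same order on the face as on the whole
    box. *)
Lemma pmap_index_in_enum (w : {set 'I_d}) : u \subset w ->
  pmap index_in (enum w) = enum 'I_#|u|.
Proof.
move=> uw.
have pmap_filter s : pmap index_in s = pmap index_in [seq j <- s | j \in u].
  elim: s => //= j s IH; case: index_inP => [i ->|ju] /=.
    by rewrite enum_valP /= index_in_enum_val/= IH.
  by rewrite (negbTE ju).
rewrite pmap_filter.
have -> : [seq j <- enum w | j \in u] = [seq enum_val i | i <- enum 'I_#|u|].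
  have -> : [seq j <- enum w | j \in u] = enum u.
    rewrite -filter_predI; apply: eq_filter => j /=; apply: andb_idr.
    exact: (fintype.subsetP uw).
  have sE : size (enum u) = size [seq enum_val i | i <- enum 'I_#|u|].
    by rewrite size_map size_enum_ord cardE.
  move: sE.
  case E : (enum u) => [|x0 s0]; first by move=> /esym/size0nil.
  rewrite -E => sE; apply: (eq_from_nth (x0 := x0)) => // k ks.
  have ku : (k < #|u|)%N by rewrite cardE.
  rewrite (nth_map (Ordinal ku)) ?size_enum_ord//.
  have := nth_ord_enum (Ordinal ku) (Ordinal ku); rewrite /= => ->.
  by rewrite (enum_val_nth x0).
by elim: (enum _) => //= i s ->; rewrite index_in_enum_val.
Qed.

End product_functions.

Section test_functions.
Context {R : realType}.

Lemma closureE_subset (T : topologicalType) (A F : set T) :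
  closed F -> A `<=` F -> closure A `<=` F.
Proof. by move=> cF AF; rewrite closureE; apply: smallest_sub. Qed.

Lemma open_box_box n (a b : 'rV[R]_n) : open_box a b `<=` box a b.
Proof. by move=> x H j; have /andP[ax xb] := H j; rewrite !ltW. Qed.

(** Compactness of the support follows from its inclusion in the open box. *)
Lemma test_functionI n (a b : 'rV[R]_n) phi : smooth phi ->
  closure [set x | phi x != 0] `<=` open_box a b -> test_function a b phi.
Proof.
move=> sphi cphi; split => //; apply: subclosed_compact (@compact_box _ _ a b) _.
  exact: closed_closure.
exact: subset_trans (@open_box_box _ a b).
Qed.

(** The complement of the support is open, so that derivatives vanish on it as
    well. *)
Lemma test_function_eq0 n (a b : 'rV[R]_n) phi s x : test_function a b phi ->
  ~ open_box a b x -> iter_partial s phi x = 0.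
Proof.
move=> [_ _ cphi] xab.
have {xab} : ~ closure [set x | phi x != 0] x by move=> /cphi.
elim: s x => [|j s IH] x xK /=.
  by apply/eqP/negPn/negP => phix; apply/xK/subset_closure.
have oK : open (~` closure [set x | phi x != 0]).
  by rewrite openC; exact: closed_closure.
rewrite /partial (near_eq_derive (g := fun=> 0)) ?derive_cst//.
by apply: filterS (open_nbhs_nbhs (conj oK xK)) => y; exact: IH.
Qed.

Section prodfun.
Variables (d : nat) (u : {set 'I_d}) (a b : 'rV[R]_d).

Lemma test_prodfun phi chi :
  test_function (restr u a) (restr u b) phi ->
  (forall j, smooth1 (chi j)) ->
  (forall j, j \notin u -> exists2 r : R, 0 < r & forall t : R,
     t < a ord0 j + r \/ b ord0 j - r < t -> chi j t = 0) ->
  test_function a b (prodfun phi chi).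
Proof.
move=> [sphi _ cphi] schi chi0; apply: test_functionI.
  exact: smooth_prodfun.
have in_u : closure [set x | prodfun phi chi x != 0] `<=`
    @restr R d u @^-1` closure [set y | phi y != 0].
  apply: closureE_subset.
    by apply: closed_comp; [move=> x _; exact: restr_continuous|exact: closed_closure].
  move=> x /=; rewrite /prodfun mulf_eq0 negb_or => /andP[phix _].
  exact: subset_closure.
have out_u j : j \notin u -> closure [set x | prodfun phi chi x != 0] `<=`
    [set x | a ord0 j < x ord0 j < b ord0 j].
  move=> ju; have [r r0 rP] := chi0 j ju.
  apply: (@subset_trans _ ((fun x : 'rV[R]_d => x ord0 j) @^-1`
    `[a ord0 j + r, b ord0 j - r]%classic)).
    apply: closureE_subset.
      apply: closed_comp; first by move=> x _; exact: coord_continuous.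
      exact: itv_closed.
    move=> x /=; rewrite /prodfun in_itv/= !leNgt -negb_or.
    apply: contra => /orP H; rewrite (bigD1 j)//= rP ?mul0r ?mulr0//.
  move=> x /=; rewrite in_itv/= => /andP[h1 h2]; apply/andP; split; lra.
move=> x xK j; case: (index_inP u j) => [i ->|ju]; last exact: out_u.
by have := cphi _ (in_u _ xK) i; rewrite !mxE.
Qed.

Lemma count_mem_enum (w : {set 'I_d}) j : count_mem j (enum w) = (j \in w).
Proof. by rewrite count_uniq_mem ?enum_uniq// mem_enum. Qed.

End prodfun.

(** The case where u is empty: the remaining factor is a function on R^0. *)
Lemma test_prod d (a b : 'rV[R]_d) chi :
  (forall j, smooth1 (chi j)) ->
  (forall j, exists2 r : R, 0 < r & forall t : R,
     t < a ord0 j + r \/ b ord0 j - r < t -> chi j t = 0) ->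
  test_function a b (fun x => \prod_j chi j (x ord0 j)) /\
  iter_partial (enum (finset.setT : {set 'I_d})) (fun x => \prod_j chi j (x ord0 j)) =
    (fun x => \prod_j derive1 (chi j) (x ord0 j)).
Proof.
move=> schi chi0.
have no (i : 'I_#|(finset.set0 : {set 'I_d})|) : False by have := enum_valP i; rewrite inE.
pose one : 'rV[R]_#|(finset.set0 : {set 'I_d})| -> R := fun=> 1.
have nos (s : seq 'I_#|(finset.set0 : {set 'I_d})|) : iter_partial s one = one.
  by case: s => // i; case: (no i).
have one_test : test_function (restr finset.set0 a) (restr finset.set0 b) one.
  apply: test_functionI; last by move=> y _ i; case: (no i).
  move=> s; rewrite nos; split; first exact: cst_continuous.
  by move=> i; case: (no i).
have -> : (fun x : 'rV[R]_d => \prod_j chi j (x ord0 j)) = prodfun one chi.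
  apply/funext => x; rewrite /prodfun mul1r; apply: eq_bigl => j.
  by rewrite inE.
split; first by apply: test_prodfun => // j _; exact: chi0.
rewrite iter_partial_prodfun//; last by case: one_test.
rewrite nos; apply/funext => x; rewrite /prodfun mul1r.
by apply: eq_big => j; [rewrite inE|rewrite count_mem_enum finset.in_setT].
Qed.

End test_functions.

(** * Approximation of point evaluations *)

Section product_integral.
Context {R : realType}.

Lemma measurable_prod_coord n (h : 'I_n -> R -> R) :
  (forall j, measurable_fun setT (h j)) ->
  measurable_fun setT (fun x : 'rV[R]_n => \prod_j h j (x ord0 j)).
Proof.
move=> mh; apply: measurable_prod => j _.
exact: (measurableT_comp (mh j) (measurable_coord j)).
Qed.

Lemma integral_prod n (h : 'I_n -> R -> R) :
  (forall j, measurable_fun setT (h j)) -> (forall j t, 0 <= h j t) ->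
  (forall j, \int[lebesgue_measure]_t (h j t)%:E = 1)%E ->
  (\int[lebesgue_rV n]_x (\prod_j h j (x ord0 j))%:E = 1)%E.
Proof.
elim: n h => [|n IH] h mh h0 h1.
  under eq_integral do rewrite big_ord0.
  by rewrite integral_cst// mul1e /= /lebesgue_nil diracE mem_set.
rewrite (split_tonelli (split_rV_cons n)).
- rewrite -[RHS](h1 ord0); apply: eq_integral => t _.
  transitivity (\int[lebesgue_rV n]_x ((h ord0 t)%:E *
      (\prod_j h (lift ord0 j) (x ord0 j))%:E))%E.
    apply: eq_integral => x _; rewrite big_ord_recl rV_cons0 EFinM.
    by congr (_ * _%:E)%E; apply: eq_bigr => j _; rewrite rV_consS.
  rewrite ge0_integralZl//=.
  + by rewrite (IH (fun j => h (lift ord0 j)))// mule1.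
  + apply/measurable_EFinP.
    exact: (@measurable_prod_coord n (fun j => h (lift ord0 j))).
  + by move=> x _; rewrite lee_fin prodr_ge0.
  + by rewrite lee_fin.
- by apply/measurable_EFinP; exact: measurable_prod_coord.
- by move=> x; rewrite lee_fin prodr_ge0.
Qed.

Lemma integral_box_prod n (a b : 'rV[R]_n) (h : 'I_n -> R -> R) :
  (forall j, measurable_fun setT (h j)) -> (forall j t, 0 <= h j t) ->
  (forall j, \int[lebesgue_measure]_(t in `[a ord0 j, b ord0 j]) (h j t)%:E = 1)%E ->
  (\int[lebesgue_rV n]_(x in box a b) (\prod_j h j (x ord0 j))%:E = 1)%E.
Proof.
move=> mh h0 h1.
rewrite -[RHS](@integral_prod n (fun j => h j \_ `[a ord0 j, b ord0 j])).
- rewrite integral_mkcond; apply: eq_integral => x _; rewrite patchE.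
  case: ifPn => [xab|xab].
    congr EFin; apply: eq_bigr => j _; rewrite patchE ifT// inE/= in_itv/=.
    by move: xab; rewrite inE; exact.
  have /existsNP[j xj] : ~ box a b x by move: xab; rewrite notin_setE.
  rewrite (bigD1 j)//= patchE ifF ?mul0r//.
  by apply/negbTE; rewrite notin_setE/= in_itv/=.
- move=> j; apply/(measurable_restrictT _ (measurable_itv _)).
  by apply: measurable_funTS; exact: mh.
- by move=> j t; rewrite patchE; case: ifP => _; [exact: h0|exact: lexx].
- move=> j; rewrite -[RHS](h1 j) [RHS]integral_mkcond; apply: eq_integral => t _.
  by rewrite restrict_EFin.
Qed.

Lemma smooth1_FTC (s : R -> R) (a b : R) : a < b -> smooth1 s ->
  (\int[lebesgue_measure]_(t in `[a, b]) (derive1 s t)%:E = (s b - s a)%:E)%E.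
Proof.
move=> ab ss; rewrite (@continuous_FTC2 _ (derive1 s) s) ?EFinB//.
- apply: continuous_subspaceT; exact/smooth1_continuous/smooth1_derive1.
- split.
  + by move=> t _; exact: smooth1_derivable.
  + exact/cvg_at_right_filter/smooth1_continuous.
  + exact/cvg_at_left_filter/smooth1_continuous.
Qed.

End product_integral.

Section mollification.
Context {R : realType} {n : nat}.
Variables a b c : 'rV[R]_n.
Hypothesis ab : forall j, a ord0 j < b ord0 j.
Hypothesis abc : box a b c.

Lemma mbounded_coord_continuous (h : R -> R) j : continuous h ->
  mbounded a b (fun x => h (x ord0 j)).
Proof.
move=> ch; apply: mbounded_continuous => x.
apply: (@continuous_comp _ _ _ (fun y : 'rV[R]_n => y ord0 j) h).
  exact: coord_continuous.
exact: ch.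
Qed.

(** An approximation of the Dirac mass at c, also if c lies on the boundary of
    the box. *)
Definition peak k (x : 'rV[R]_n) : R :=
  \prod_j derive1 (jump (a ord0 j) (b ord0 j) (c ord0 j) k) (x ord0 j).

Let cab j : a ord0 j <= c ord0 j <= b ord0 j. Proof. exact: abc. Qed.

Lemma smooth1_derive1_continuous (h : R -> R) : smooth1 h -> continuous (derive1 h).
Proof. by move=> sh; exact/smooth1_continuous/smooth1_derive1. Qed.

Lemma mbounded_peak k : mbounded a b (peak k).
Proof.
apply: mbounded_prod => j _; apply: mbounded_coord_continuous.
exact/smooth1_derive1_continuous/smooth1_jump.
Qed.

Lemma peak_ge0 k x : 0 <= peak k x.
Proof. by apply: prodr_ge0 => j _; exact: derive1_jump_ge0. Qed.

Lemma integral_peak k :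
  (\int[lebesgue_rV n]_(x in box a b) (peak k x)%:E = 1)%E.
Proof.
apply: (@integral_box_prod _ _ a b
  (fun j => derive1 (jump (a ord0 j) (b ord0 j) (c ord0 j) k))).
- move=> j; apply: continuous_measurable_fun.
  exact/smooth1_derive1_continuous/smooth1_jump.
- by move=> j t; exact: derive1_jump_ge0.
- move=> j; rewrite smooth1_FTC//; last exact: smooth1_jump.
  have [r r0 [j0 j1]] := jump_margin (ab j) (cab j) k.
  by rewrite j1 ?j0 ?subr0// ?lerDl ?lerBlDr ?lerDl ltW.
Qed.

(** The peak is nonnegative, has integral 1, and vanishes as soon as one
    coordinate is at distance r from c; within that distance G is close to G
    c. *)
Lemma mollify (G : 'rV[R]_n -> R) : {within box a b, continuous G} ->
  \int[lebesgue_rV n]_(x in box a b) (G x * peak k x) @[k --> \oo] --> G c.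
Proof.
move=> cG; have mG := mbounded_within cG.
have abW j : a ord0 j <= b ord0 j by exact: ltW.
have mB := measurable_box a b.
apply/cvgrPdist_le => e e0.
have [r r0 Gr] := (within_boxP _ _ _).1 cG c abc e e0.
have nearj : \forall k \near \oo, forall j t, r <= `|t - c ord0 j| ->
    derive1 (jump (a ord0 j) (b ord0 j) (c ord0 j) k) t = 0.
  by apply: filter_forall => j; exact: derive1_jump_eq0.
apply: filterS nearj => k kP.
have ip := mbounded_integrable abW (mbounded_peak k).
have i1 := mbounded_integrable abW (mboundedM (mbounded_cst a b (G c)) (mbounded_peak k)).
have i2 := mbounded_integrable abW (mboundedM mG (mbounded_peak k)).
have I1 : \int[lebesgue_rV n]_(x in box a b) peak k x = 1.
  by rewrite /Rintegral integral_peak.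
rewrite -[G c]mulr1 -{1}I1 -RintegralZl// -RintegralB//.
have -> : e = \int[lebesgue_rV n]_(x in box a b) (e * peak k x).
  by rewrite RintegralZl// I1 mulr1.
have iB : (lebesgue_rV n).-integrable (box a b)
    (EFin \o (fun x => G c * peak k x - G x * peak k x)).
  exact: (@integrableB _ _ _ _ _ mB _ _ i1 i2).
apply: le_trans (le_normr_Rintegral mB iB) _.
apply: le_Rintegral => //.
- exact: (@integrable_norm _ _ _ _ _ _ iB).
- exact: mbounded_integrable (mboundedM (mbounded_cst a b e) (mbounded_peak k)).
move=> x xab; rewrite -mulrBl normrM (ger0_norm (peak_ge0 _ _)).
have [H|/existsNP[j /negP]] := pselect (forall j, `|x ord0 j - c ord0 j| < r).
  by rewrite ler_wpM2r ?peak_ge0// distrC ltW// Gr.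
rewrite -leNgt => rj.
have -> : peak k x = 0.
  by apply/eqP/prodf_eq0; exists j => //; apply/eqP; exact: kP.
by rewrite !mulr0.
Qed.

End mollification.

(** * Alternating sums over the vertices of a box *)

Section vertex_bound.
Context {R : realType} {n : nat}.
Variables a b p q : 'rV[R]_n.
Hypothesis ab : forall j, a ord0 j < b ord0 j.
Hypotheses (pab : box a b p) (qab : box a b q).

Let abW j : a ord0 j <= b ord0 j. Proof. exact: ltW. Qed.

Definition vertex (J : {set 'I_n}) : 'rV[R]_n :=
  \row_j (if j \in J then q ord0 j else p ord0 j).

Lemma vertex_box J : box a b (vertex J).
Proof. by move=> j; rewrite mxE; case: ifP. Qed.

(** Approximates the signed indicator of the interval between p_j and q_j; its
    derivative approximates the difference of the Dirac masses at p_j and q_j.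
    *)
Definition jump_diff k j (t : R) : R :=
  jump (a ord0 j) (b ord0 j) (p ord0 j) k t -
  jump (a ord0 j) (b ord0 j) (q ord0 j) k t.

Lemma smooth1_jump_diff k j : smooth1 (jump_diff k j).
Proof.
have -> : jump_diff k j = jump (a ord0 j) (b ord0 j) (p ord0 j) k +
    cst (-1) * jump (a ord0 j) (b ord0 j) (q ord0 j) k.
  by apply/funext => t; rewrite !fctE/= mulN1r.
apply: smooth1D; first exact: smooth1_jump.
by apply: smooth1M; [exact: smooth1_cst|exact: smooth1_jump].
Qed.

Lemma jump_diff_le1 k j t : `|jump_diff k j t| <= 1.
Proof.
rewrite /jump_diff; set s := jump _ _ _ _ t; set s' := jump _ _ _ _ t.
have [s0 s1 s'0 s'1] : [/\ 0 <= s, s <= 1, 0 <= s' & s' <= 1].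
  by split; rewrite ?jump_ge0 ?jump_le1.
by rewrite ler_norml; apply/andP; split; lra.
Qed.

Lemma derive1_jump_diff k j t : derive1 (jump_diff k j) t =
  derive1 (jump (a ord0 j) (b ord0 j) (p ord0 j) k) t -
  derive1 (jump (a ord0 j) (b ord0 j) (q ord0 j) k) t.
Proof.
apply: derive1_sub; exact/smooth1_derivable/smooth1_jump.
Qed.

Lemma jump_diff_margin k j : exists2 r : R, 0 < r & forall t : R,
  t < a ord0 j + r \/ b ord0 j - r < t -> jump_diff k j t = 0.
Proof.
have [r r0 [p0 p1]] := jump_margin (ab j) (pab j) k.
have [s s0 [q0 q1]] := jump_margin (ab j) (qab j) k.
exists (Num.min r s); first by rewrite lt_min r0.
have mr : Num.min r s <= r by rewrite ge_min lexx.
have ms : Num.min r s <= s by rewrite ge_min lexx orbT.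
move: (Num.min r s) mr ms => m mr ms.
move=> t [tm|tm]; rewrite /jump_diff.
  by rewrite p0 ?q0 ?subr0//; lra.
by rewrite p1 ?q1 ?subrr//; lra.
Qed.

Let peakJ k (x : 'rV[R]_n) : \prod_j derive1 (jump_diff k j) (x ord0 j) =
  \sum_(J : {set 'I_n}) (-1) ^+ #|J| * peak a b (vertex J) k x.
Proof.
under eq_bigr do rewrite derive1_jump_diff.
rewrite prodrB_subsets; apply: eq_bigr => J _; congr (_ * _).
by apply: eq_bigr => j _; rewrite mxE; case: ifP.
Qed.

(** Testing with the product of the [jump_diff], the alternating sum is a
    limit of integrals of h times a mixed derivative, that is, up to sign, of
    w times a function bounded by 1. It is therefore bounded by the L_1 norm
    of w, to which Cauchy-Schwarz applies. *)
Lemma vertex_bound (h w : 'rV[R]_n -> R) : {within box a b, continuous h} ->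
  is_weak_deriv a b finset.setT h w ->
  (`|\sum_(J : {set 'I_n}) (-1) ^+ #|J| * h (vertex J)|%:E <=
   L2norm a b w * ((\prod_j (b ord0 j - a ord0 j)) `^ 2^-1)%:E)%E.
Proof.
move=> ch [wL wP].
have mB := measurable_box a b.
have [mw _] := (L2_onP _ _ w).1 wL.
have mh := mbounded_within ch.
set M := (X in (_ <= X)%E).
have Mfin : M \is a fin_num by rewrite fin_numM// L2norm_fin.
have cv : \int[lebesgue_rV n]_(x in box a b)
    (h x * \prod_j derive1 (jump_diff k j) (x ord0 j)) @[k --> \oo] -->
  \sum_(J : {set 'I_n}) (-1) ^+ #|J| * h (vertex J).
  have mhp k J : mbounded a b (fun x => h x * peak a b (vertex J) k x).
    by apply: mboundedM => //; exact: mbounded_peak.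
  have E k : \int[lebesgue_rV n]_(x in box a b)
      (h x * \prod_j derive1 (jump_diff k j) (x ord0 j)) =
      \sum_(J : {set 'I_n}) (-1) ^+ #|J| *
        \int[lebesgue_rV n]_(x in box a b) (h x * peak a b (vertex J) k x).
    under [RHS]eq_bigr => J _.
      rewrite -RintegralZl//; last exact: mbounded_integrable.
      over.
    rewrite -Rintegral_sum//; last first.
      move=> J; apply: mbounded_integrable => //.
      by apply: mboundedM => //; exact: mbounded_cst.
    apply: eq_Rintegral => x _; rewrite peakJ mulr_sumr.
    by apply: eq_bigr => J _; rewrite mulrCA.
  under eq_fun do rewrite E.
  apply: cvg_sumr => J _; apply: cvgMl_tmp.
  by apply: mollify => //; exact: vertex_box.
have le k : `|\int[lebesgue_rV n]_(x in box a b)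
    (h x * \prod_j derive1 (jump_diff k j) (x ord0 j))| <= fine M.
  have [tf tE] := test_prod (smooth1_jump_diff k) (jump_diff_margin k).
  have := wP _ tf; rewrite tE => ->.
  rewrite normrM normrX normrN1 expr1n mul1r.
  have [stf _ _] := tf.
  have mt := mbounded_continuous a b (stf [::]).1.
  have iwt := mboundedM_integrable abW mt wL.
  have iwt' : (lebesgue_rV n).-integrable (box a b)
      (EFin \o (fun x => w x * \prod_j jump_diff k j (x ord0 j))).
    by apply: eq_integrable iwt => // x _ /=; rewrite mulrC.
  apply: le_trans (le_normr_Rintegral mB iwt') _.
  have iw := L2_integrable abW wL.
  apply: (@le_trans _ _ (\int[lebesgue_rV n]_(x in box a b) `|w x|)).
    apply: le_Rintegral => //.
    - exact: (integrable_norm iwt').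
    - exact: (integrable_norm iw).
    - move=> x _; rewrite normrM ler_piMr// normr_prod.
      by apply: prodr_ile1 => j _; rewrite normr_ge0 jump_diff_le1.
  have fI := integrable_fin_num mB (integrable_norm iw).
  rewrite /Rintegral -lee_fin (fineK Mfin) (fineK fI).
  exact: cauchy_schwarz_box.
rewrite -(fineK Mfin) lee_fin.
exact: cvg_norm_le le cv.
Qed.

End vertex_bound.

(** * Faces of a box *)

Section faces.
Context {R : realType} {d : nat} (u : {set 'I_d}).
Variables a b : 'rV[R]_d.
Hypothesis ab : forall j, a ord0 j < b ord0 j.

Notation au := (restr u a).
Notation bu := (restr u b).
Notation ac := (restr (~: u) a).
Notation bc := (restr (~: u) b).
Notation leb := (lebesgue_rV (R := R)).

Lemma restr_lt v j : restr v a ord0 j < restr v b ord0 j.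
Proof. by rewrite !mxE. Qed.

Lemma restr_le v j : restr v a ord0 j <= restr v b ord0 j.
Proof. exact/ltW/restr_lt. Qed.

Lemma restr_assemble y z : restr u (@assemble R d u (y, z)) = y.
Proof. by apply/rowP => i; rewrite mxE assemble_in. Qed.

Lemma assemble_restr (c : 'rV[R]_d) y : @assemble R d u (y, restr (~: u) c) = anchor c y.
Proof.
apply/rowP; apply: (@forall_setC _ u) => i; first by rewrite assemble_in anchor_in.
have iu : enum_val i \notin u by have := enum_valP i; rewrite inE.
by rewrite assemble_out anchor_out// mxE.
Qed.

Lemma box_assemble y z : box a b (@assemble R d u (y, z)) <-> box au bu y /\ box ac bc z.
Proof.
split => [H|[Hy Hz]].
  split => i; first by have := H (enum_val i); rewrite assemble_in !mxE.
  by have := H (enum_val i); rewrite assemble_out !mxE.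
apply: (@forall_setC _ u) => i.
  by have := Hy i; rewrite assemble_in !mxE.
by have := Hz i; rewrite assemble_out !mxE.
Qed.

Lemma box_restr v x : box a b x -> box (restr v a) (restr v b) (restr v x).
Proof. by move=> xab j; rewrite !mxE. Qed.

Lemma restrict_assemble (T : pointedType) (F : 'rV[R]_d -> T) y z :
  (F \_ (box a b)) (@assemble R d u (y, z)) =
  ((fun y => ((fun z => F (@assemble R d u (y, z))) \_ (box ac bc)) z)
     \_ (box au bu)) y.
Proof.
rewrite !patchE.
case: (boolP (y \in box au bu)) => [|/negbTE yN]; last first.
  rewrite ifF//; apply/negbTE/negP; rewrite inE => /box_assemble[+ _].
  by move/mem_set; rewrite yN.
rewrite inE => yu; case: (boolP (z \in box ac bc)) => [|/negbTE zN].
  by rewrite inE => zc; rewrite ifT// inE; exact/box_assemble.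
rewrite ifF//; apply/negbTE/negP; rewrite inE => /box_assemble[_].
by move/mem_set; rewrite zN.
Qed.

Lemma measurable_section (F : 'rV[R]_d -> R) y : measurable_fun (box a b) F ->
  box au bu y -> measurable_fun (box ac bc) (fun z => F (@assemble R d u (y, z))).
Proof.
move=> mF yu; apply/(measurable_restrictT _ (measurable_box ac bc)).
have mF' : measurable_fun setT (F \_ (box a b)).
  exact/(measurable_restrictT _ (measurable_box a b)).
have := measurableT_comp (measurableT_comp mF' (@measurable_assemble R d u))
  (pair1_measurable y).
congr (measurable_fun _ _); apply/funext => z.
by rewrite /= restrict_assemble patchE mem_set.
Qed.

Let tonelli_inner (F : 'rV[R]_d -> \bar R) y :
  (\int[leb #|~: u|]_z (F \_ (box a b)) (@assemble R d u (y, z)) =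
  ((fun y => \int[leb #|~: u|]_(z in box ac bc) F (assemble (y, z)))
    \_ (box au bu)) y)%E.
Proof.
under eq_integral do rewrite restrict_assemble.
rewrite [RHS]patchE; case: ifP => yu; last first.
  by under eq_integral do rewrite patchE yu; exact: integral0.
rewrite [RHS]integral_mkcond; apply: eq_integral => z _.
by rewrite patchE yu.
Qed.

Lemma measurable_box_tonelli (F : 'rV[R]_d -> \bar R) :
  measurable_fun (box a b) F -> (forall x, (0 <= F x)%E) ->
  measurable_fun (box au bu)
    (fun y => \int[leb #|~: u|]_(z in box ac bc) F (@assemble R d u (y, z)))%E.
Proof.
move=> mF F0; apply/(measurable_restrictT _ (measurable_box au bu)).
have mF' : measurable_fun setT (F \_ (box a b)).
  exact/(measurable_restrictT _ (measurable_box a b)).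
have := @measurable_fun_fubini_tonelli_F _ _ _ _ R (leb #|~: u|)
  (fun p => (F \_ (box a b)) (@assemble R d u p))
  (measurableT_comp mF' (@measurable_assemble R d u)).
move=> /(_ _)/wrap[]; first by move=> p; rewrite patchE; case: ifP.
by congr (measurable_fun _ _); apply/funext => y; exact: tonelli_inner.
Qed.

Lemma box_tonelli (F : 'rV[R]_d -> \bar R) :
  measurable_fun (box a b) F -> (forall x, (0 <= F x)%E) ->
  (\int[leb d]_(x in box a b) F x =
   \int[leb #|u|]_(y in box au bu) \int[leb #|~: u|]_(z in box ac bc)
      F (assemble (y, z)))%E.
Proof.
move=> mF F0; rewrite integral_mkcond (split_tonelli (split_assemble u)).
- rewrite [RHS]integral_mkcond; apply: eq_integral => y _; exact: tonelli_inner.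
- by apply/(measurable_restrictT _ (measurable_box a b)).
- by move=> x; rewrite patchE; case: ifP.
Qed.

Lemma box_fubini (F : 'rV[R]_d -> R) :
  (leb d).-integrable (box a b) (EFin \o F) ->
  [/\ {ae leb #|u|, forall y, box au bu y ->
        (leb #|~: u|).-integrable (box ac bc) (fun z => (F (assemble (y, z)))%:E)},
      (leb #|u|).-integrable (box au bu)
        (fun y => (\int[leb #|~: u|]_(z in box ac bc) F (assemble (y, z)))%:E) &
      \int[leb d]_(x in box a b) F x =
      \int[leb #|u|]_(y in box au bu) \int[leb #|~: u|]_(z in box ac bc)
        F (assemble (y, z))].
Proof.
move=> iF; have mB := measurable_box a b.
have mBu := measurable_box au bu; have mBc := measurable_box ac bc.
have iF' : (leb d).-integrable setT (EFin \o (F \_ (box a b))).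
  rewrite -restrict_EFin; apply/integrable_restrict => //.
  by rewrite setTI.
have [ae1 i1 E] := split_fubini (split_assemble u) iF'.
have inner y : \int[leb #|~: u|]_z (F \_ (box a b)) (assemble (y, z)) =
    ((fun y => \int[leb #|~: u|]_(z in box ac bc) F (assemble (y, z)))
      \_ (box au bu)) y.
  under eq_Rintegral do rewrite restrict_assemble.
  rewrite [RHS]patchE; case: ifP => yu; last first.
    under eq_Rintegral do rewrite patchE yu.
    by rewrite Rintegral_cst// mul0r.
  rewrite [RHS]Rintegral_mkcond; apply: eq_Rintegral => z _.
  by rewrite patchE yu.
split.
- apply: filterS ae1 => y iy yu.
  rewrite -(setTI (box ac bc)); apply/integrable_restrict => //.
  apply: eq_integrable iy => // z _.
  by rewrite restrict_assemble patchE mem_set//= restrict_EFin.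
- rewrite -(setTI (box au bu)); apply/integrable_restrict => //.
  apply: eq_integrable i1 => // y _.
  by rewrite inner !patchE; case: ifP.
- rewrite Rintegral_mkcond E [RHS]Rintegral_mkcond.
  by apply: eq_Rintegral => y _; exact: inner.
Qed.

End faces.

(** * Weak derivatives of sections *)

Section face_derivative.
Context {R : realType} {d : nat} (u : {set 'I_d}).
Variables a b c : 'rV[R]_d.
Hypothesis ab : forall j, a ord0 j < b ord0 j.
Hypothesis abc : box a b c.
Variable f : 'rV[R]_d -> R.
Hypothesis fH1 : H1mix a b f.

Notation au := (restr u a).
Notation bu := (restr u b).
Notation ac := (restr (~: u) a).
Notation bc := (restr (~: u) b).
Notation leb := (lebesgue_rV (R := R)).

Let abW j : a ord0 j <= b ord0 j. Proof. exact: ltW. Qed.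
Let abc' := restr_lt (v := ~: u) ab.
Let abuW := restr_le (v := u) ab.
Let abcW := restr_le (v := ~: u) ab.

Let g (v : {set 'I_d}) := weak_deriv a b (u :|: v) f.

Let gP v : is_weak_deriv a b (u :|: v) f (g v).
Proof. by apply: xgetPex; exact: (fH1.2 (u :|: v)). Qed.

Let gL v : L2_on a b (g v). Proof. by have [] := gP v. Qed.

Let s k j : R -> R := jump (a ord0 j) (b ord0 j) (c ord0 j) k.

Let slim j : R -> R := jump_lim (a ord0 j) (b ord0 j) (c ord0 j).

Let smooth_s k j : smooth1 (s k j).
Proof. exact: smooth1_jump. Qed.

(** The factor in the frozen variable j: the kernel K if f is differentiated
    in this variable, and rho otherwise. Here rho is the derivative of the
    jump number 0 and K is smoothed by the jump number k. *)
Let chi (v : {set 'I_d}) k j : R -> R :=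
  if j \in v then s 0 j - s k j else derive1 (s 0 j).

(** The factor for the exact kernel K. *)
Let chi_lim (v : {set 'I_d}) j : R -> R :=
  if j \in v then s 0 j - slim j else derive1 (s 0 j).

Let smooth_chi v k j : smooth1 (chi v k j).
Proof.
rewrite /chi; case: ifP => _; last exact: smooth1_derive1.
have -> : s 0 j - s k j = s 0 j + cst (-1) * s k j.
  by apply/funext => t; rewrite !fctE/= mulN1r.
by apply: smooth1D => //; apply: smooth1M => //; exact: smooth1_cst.
Qed.

Let chi_cvg v j t : chi v k j t @[k --> \oo] --> chi_lim v j t.
Proof.
rewrite /chi /chi_lim; case: (j \in v); last exact: cvg_cst.
by apply: cvgB; [exact: cvg_cst|exact: jump_cvg].
Qed.

Let chi_bound v k j t : `|chi v k j t| <= 1 + `|derive1 (s 0 j) t|.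
Proof.
rewrite /chi; case: ifP => _; last by rewrite lerDr.
rewrite (@le_trans _ _ 1) ?lerDl// !fctE.
set p := s 0 j t; set q := s k j t.
have [p0 p1 q0 q1] : [/\ 0 <= p, p <= 1, 0 <= q & q <= 1].
  by split; rewrite ?jump_ge0 ?jump_le1.
by rewrite ler_norml; apply/andP; split; lra.
Qed.

Let chi_margin v k j : exists2 r : R, 0 < r & forall t : R,
  t < a ord0 j + r \/ b ord0 j - r < t -> chi v k j t = 0.
Proof.
have [r r0 [p0 p1]] := jump_margin (ab j) (abc j) 0.
have [r' r'0 [q0 q1]] := jump_margin (ab j) (abc j) k.
exists (Num.min r r'); first by rewrite lt_min r0.
have mr : Num.min r r' <= r by rewrite ge_min lexx.
have ms : Num.min r r' <= r' by rewrite ge_min lexx orbT.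
move: (Num.min r r') mr ms => m mr ms.
rewrite /chi => t [tm|tm]; case: ifP => _; rewrite ?fctE/=.
- by rewrite /s p0 ?q0 ?subr0//; lra.
- apply: (@derive1_near_cst _ _ 0); have : t < a ord0 j + m by [].
  by move=> /lt_nbhsl; apply: filterS => x H; rewrite /s p0//; lra.
- by rewrite /s p1 ?q1 ?subrr//; lra.
- apply: (@derive1_near_cst _ _ 1); have : b ord0 j - m < t by [].
  by move=> /lt_nbhsr; apply: filterS => x H; rewrite /s p1//; lra.
Qed.

Let derive1_chi (v : {set 'I_d}) k j t : derive1n (j \in v) (chi v k j) t =
  if j \in v then derive1 (s 0 j) t - derive1 (s k j) t else derive1 (s 0 j) t.
Proof.
rewrite /chi; case: ifP => _ //=.
have ds l : derivable (s l j) t 1 by exact/smooth1_derivable/smooth_s.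
exact: derive1_sub.
Qed.

Let kappa v k (x : 'rV[R]_d) : R := \prod_(j | j \notin u) chi v k j (x ord0 j).

Let kappa_lim v (x : 'rV[R]_d) : R :=
  \prod_(j | j \notin u) chi_lim v j (x ord0 j).

(** A bound of all [kappa v k], uniform in v and k. *)
Let kdom (x : 'rV[R]_d) : R :=
  \prod_(j | j \notin u) (1 + `|derive1 (s 0 j) (x ord0 j)|).

Let mkappa v k : mbounded a b (kappa v k).
Proof.
apply: mbounded_prod => j _; apply: mbounded_coord_continuous.
exact/smooth1_continuous/smooth_chi.
Qed.

Let mkdom : mbounded a b kdom.
Proof.
apply: mbounded_prod => j _.
apply: (@mbounded_coord_continuous _ _ _ _ (fun t => 1 + `|derive1 (s 0 j) t|)).
move=> t; apply: cvgD; first exact: cvg_cst.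
apply: cvg_norm; exact: (smooth1_derive1_continuous (smooth_s 0 j)).
Qed.

Let kappa_bound v k x : `|kappa v k x| <= kdom x.
Proof.
by rewrite normr_prod; apply: ler_prod => j _; rewrite normr_ge0 chi_bound.
Qed.

Let kappa_cvg v x : kappa v k x @[k --> \oo] --> kappa_lim v x.
Proof. by apply: cvg_prodr => j _; exact: chi_cvg. Qed.

Let kappa_lim_bound v x : `|kappa_lim v x| <= kdom x.
Proof.
exact: (cvg_norm_le (fun k => kappa_bound v k x) (@kappa_cvg v x)).
Qed.

Let mkappa_lim v : mbounded a b (kappa_lim v).
Proof.
split.
  apply: (measurable_fun_cvg (h := kappa v)); last by move=> x _; exact: kappa_cvg.
  by move=> k; have [] := mkappa v k.
have [_ [M HM]] := mkdom; exists M => x xab.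
by rewrite (le_trans (kappa_lim_bound v x))// (le_trans (ler_norm _))// HM.
Qed.

(** The representation of D^u h, before integration over the frozen variables.
    *)
Let W (x : 'rV[R]_d) : R :=
  \sum_(v : {set 'I_d} | v \subset ~: u) kappa_lim v x * g v x.

Let Wk k (x : 'rV[R]_d) : R :=
  \sum_(v : {set 'I_d} | v \subset ~: u) kappa v k x * g v x.

Let Wdom (x : 'rV[R]_d) : R :=
  \sum_(v : {set 'I_d} | v \subset ~: u) `|kdom x * g v x|.

Let WL : L2_on a b W.
Proof. by apply: L2_on_sum => // v _; exact: L2_onM. Qed.

Let WkL k : L2_on a b (Wk k).
Proof. by apply: L2_on_sum => // v _; exact: L2_onM. Qed.

Let Wk_dom k x : `|Wk k x| <= Wdom x.
Proof.
rewrite (le_trans (ler_norm_sum _ _ _))//; apply: ler_sum => v _.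
rewrite !normrM ler_wpM2r// (le_trans (kappa_bound _ _ _))//.
exact: ler_norm.
Qed.

Definition face_deriv (y : 'rV[R]_#|u|) : R :=
  \int[leb #|~: u|]_(z in box ac bc) W (assemble (y, z)).

Let h (y : 'rV[R]_#|u|) : R := f (anchor c y).

Let vol : R := \prod_j (bc ord0 j - ac ord0 j).

(** Cauchy-Schwarz in the frozen variables. *)
Let face_deriv_le y : box au bu y -> ((face_deriv y ^+ 2)%:E <= vol%:E *
   \int[leb #|~: u|]_(z in box ac bc) (W (assemble (y, z)) ^+ 2)%:E)%E.
Proof.
move=> yu; have mBc := measurable_box ac bc.
have vol0 : 0 < vol by apply: prodr_gt0 => j _; rewrite subr_gt0.
have [mW _] := (L2_onP a b W).1 WL.
have mS := measurable_section mW yu.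
have CS := cauchy_schwarz_box abcW mS.
rewrite -/vol L2normE in CS.
have : (0 <= \int[leb #|~: u|]_(z in box ac bc) (W (assemble (y, z)) ^+ 2)%:E)%E.
  by apply: integral_ge0 => z _; rewrite lee_fin sqr_ge0.
move: CS.
case: (\int[_]_(z in _) (W (assemble (y, z)) ^+ 2)%:E)%E => [r||] CS r0.
2: by rewrite gt0_muley ?lte_fin ?leey.
2: by [].
rewrite lee_fin in r0.
have iS : (leb #|~: u|).-integrable (box ac bc) (fun z => (W (assemble (y, z)))%:E).
  apply/integrableP; split; first exact/measurable_EFinP.
  by apply: (le_lt_trans CS); rewrite poweR_EFin -EFinM ltry.
rewrite -EFinM lee_fin -real_normK ?num_real//.
have fS : `|face_deriv y| <= r `^ 2^-1 * vol `^ 2^-1.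
  rewrite -lee_fin; apply: le_trans CS.
  rewrite EFin_normr_Rintegral//.
  by apply: le_abse_integral => //; exact/measurable_EFinP.
apply: (@le_trans _ _ ((r `^ 2^-1 * vol `^ 2^-1) ^+ 2)).
  by rewrite lerXn2r ?nnegrE ?mulr_ge0 ?powR_ge0.
rewrite exprMn -!powR_mulrn ?powR_ge0// -!powRrM mulVf ?pnatr_eq0//.
by rewrite !powRr1 ?(ltW vol0)// mulrC.
Qed.

Lemma face_deriv_L2 : L2_on au bu face_deriv.
Proof.
have mB := measurable_box a b.
have mBu := measurable_box au bu; have mBc := measurable_box ac bc.
have [_ i1 _] := box_fubini u (L2_integrable abW WL).
have [mW Woo] := (L2_onP a b W).1 WL.
have mW2 : measurable_fun (box a b) (fun x => (W x ^+ 2)%:E).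
  by apply/measurable_EFinP; exact: measurable_funX.
have W20 x : (0 <= (W x ^+ 2)%:E)%E by rewrite lee_fin sqr_ge0.
have mfd : measurable_fun (box au bu) face_deriv.
  by apply/measurable_EFinP; case/integrableP : i1.
apply/L2_onP => //; split => //.
move: Woo; rewrite (box_tonelli u mW2 W20) => Woo.
have vol0 : 0 < vol by apply: prodr_gt0 => j _; rewrite subr_gt0.
apply: (@le_lt_trans _ _ (\int[leb #|u|]_(y in box au bu) (vol%:E *
   \int[leb #|~: u|]_(z in box ac bc) (W (assemble (y, z)) ^+ 2)%:E)%E)%E).
  apply: ge0_le_integral => //.
  - by move=> y _; rewrite lee_fin sqr_ge0.
  - by apply/measurable_EFinP; apply: measurable_funX.
  - apply: emeasurable_funM => //.
    exact: (measurable_box_tonelli mW2 W20).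
rewrite ge0_integralZl//.
- by rewrite lte_mul_pinfty ?lee_fin ?ltW.
- exact: (measurable_box_tonelli mW2 W20).
- by move=> y _; apply: integral_ge0.
- by rewrite lee_fin ltW.
Qed.

(** Fubini's theorem gives the value of the candidate on test functions as an
    integral over the whole box. *)
Let step_fubini phi : test_function au bu phi ->
  \int[leb #|u|]_(y in box au bu) (face_deriv y * phi y) =
  \int[leb d]_(x in box a b) (phi (restr u x) * W x).
Proof.
move=> [sphi _ _].
have mBu := measurable_box au bu; have mBc := measurable_box ac bc.
have mphi : mbounded a b (fun x => phi (restr u x)).
  apply: mbounded_continuous => x.
  apply: (@continuous_comp _ _ _ (@restr R d u) phi).
    exact: restr_continuous.
  exact: (sphi [::]).1.
have [ae1 i1 _] := box_fubini u (L2_integrable abW WL).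
have [_ i2 ->] := box_fubini u (mboundedM_integrable abW mphi WL).
have mphi' : measurable_fun (box au bu) phi.
  by have [] := mbounded_continuous au bu (sphi [::]).1.
congr fine; apply: ae_eq_integral => //.
- apply/measurable_EFinP; apply: measurable_funM => //.
  by apply/measurable_EFinP; case/integrableP : i1.
- by case/integrableP : i2.
- apply: filterS ae1 => y iy yu; congr EFin.
  under [RHS]eq_Rintegral do rewrite restr_assemble.
  rewrite (RintegralZl _ mBc (iy yu)); exact: mulrC.
Qed.

(** The smoothed kernels converge pointwise and are dominated. *)
Let step_dominated phi : test_function au bu phi ->
  \int[leb d]_(x in box a b) (phi (restr u x) * Wk k x) @[k --> \oo] -->
  \int[leb d]_(x in box a b) (phi (restr u x) * W x).
Proof.
move=> [sphi _ _]; have mB := measurable_box a b.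
have mphi : mbounded a b (fun x => phi (restr u x)).
  apply: mbounded_continuous => x.
  apply: (@continuous_comp _ _ _ (@restr R d u) phi).
    exact: restr_continuous.
  exact: (sphi [::]).1.
apply: (Rintegral_dominated (g := fun x =>
  \sum_(v : {set 'I_d} | v \subset ~: u)
    `|phi (restr u x) * (kdom x * g v x)|) mB _ _ _ _).2.
- move=> k; apply: measurable_funM; first by case: mphi.
  by have [] := (L2_onP a b (Wk k)).1 (WkL k).
- move=> x xab; apply: cvgMl_tmp; apply: cvg_sumr => v _.
  by apply: cvgMr_tmp; exact: kappa_cvg.
- apply: integrable_Rsum => // v.
  have := mboundedM_integrable abW mphi (L2_onM mkdom (gL v)).
  exact: integrable_norm.
- move=> k x xab; rewrite normrM mulrC.
  apply: (@le_trans _ _ (Wdom x * `|phi (restr u x)|)).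
    by rewrite ler_wpM2r// Wk_dom.
  by rewrite mulr_suml; apply: ler_sum => v _; rewrite [leRHS]normrM mulrC.
Qed.

Let eta k j : R -> R := derive1 (s k j).

(** With smoothed kernels, the weak derivatives of f may be moved to the test
    function. In the frozen variables the alternating sum over v of the
    products of rho and of K' = rho - eta_k collapses to the product of the
    eta_k, which is a peak at c. *)
Let step_weak phi k : test_function au bu phi ->
  \int[leb d]_(x in box a b) (phi (restr u x) * Wk k x) =
  (-1) ^+ #|u| * \int[leb d]_(x in box a b)
    (f x * (iter_partial (enum (finset.setT : {set 'I_#|u|})) phi (restr u x) *
      \prod_(j | j \notin u) eta k j (x ord0 j))).
Proof.
move=> tphi; have [sphi _ _] := tphi; have mB := measurable_box a b.
have mf : mbounded a b f by apply: mbounded_within; case: fH1.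
have tprod v : test_function a b (prodfun phi (chi v k)).
  exact: (test_prodfun tphi (smooth_chi v k) (fun j _ => chi_margin v k j)).
have mprod v w : mbounded a b (iter_partial w (prodfun phi (chi v k))).
  by apply: mbounded_continuous; have [st _ _] := tprod v; exact: (st w).1.
have iprod v : (leb d).-integrable (box a b)
    (EFin \o (fun x => g v x * prodfun phi (chi v k) x)).
  apply: eq_integrable (mboundedM_integrable abW (mprod v [::]) (gL v)) => //.
  by move=> x _; rewrite /= mulrC.
have -> : \int[leb d]_(x in box a b) (phi (restr u x) * Wk k x) =
    \sum_(v : {set 'I_d} | v \subset ~: u)
      \int[leb d]_(x in box a b) (g v x * prodfun phi (chi v k) x).
  rewrite -Rintegral_sum//; apply: eq_Rintegral => x _.
  rewrite mulr_sumr; apply: eq_bigr => v _.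
  by rewrite /prodfun /kappa; ring.
have step (v : {set 'I_d}) : v \subset ~: u ->
    \int[leb d]_(x in box a b) (g v x * prodfun phi (chi v k) x) =
    (-1) ^+ #|u| * \int[leb d]_(x in box a b) ((-1) ^+ #|v| * (f x *
      iter_partial (enum (u :|: v)) (prodfun phi (chi v k)) x)).
  move=> vu; have [_ wP] := gP v.
  rewrite RintegralZl//; last exact: mbounded_integrable (mboundedM mf (mprod _ _)).
  rewrite wP// !mulrA -!exprD.
  have -> : #|u :|: v| = (#|u| + #|v|)%N.
    rewrite cardsU (_ : u :&: v = finset.set0) ?cards0 ?subn0//.
    by apply/disjoint_setI0; rewrite disjoint_sym finset.disjoints_subset.
  by rewrite addnn -mul2n exprM sqrrN expr1n expr1n mul1r.
rewrite (eq_bigr _ step) -mulr_sumr; congr (_ * _).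
rewrite -Rintegral_sum//; last first.
  move=> v; apply: mbounded_integrable => //.
  by apply: mboundedM; [exact: mbounded_cst|exact: mboundedM].
apply: eq_Rintegral => x _.
have -> : \prod_(j | j \notin u) eta k j (x ord0 j) =
    \prod_(j in ~: u) (eta 0 j (x ord0 j) -
      (eta 0 j (x ord0 j) - eta k j (x ord0 j))).
  by apply: eq_big => j; [rewrite inE|move=> _; rewrite subKr].
rewrite prodrB_subsets_in !mulr_sumr; apply: eq_bigr => v vu.
rewrite (iter_partial_prodfun _ sphi (smooth_chi v k)).
rewrite pmap_index_in_enum ?finset.subsetUl// /prodfun.
have -> : enum 'I_#|u| = enum (finset.setT : {set 'I_#|u|}).
  by apply: eq_enum => i; rewrite !inE.
rewrite !mulrA [_ * f x]mulrC -!mulrA; congr (_ * _).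
rewrite mulrCA; congr (_ * (_ * _)).
apply: eq_big => [j|j ju]; first by rewrite inE.
by rewrite count_mem_enum finset.in_setU (negbTE ju)/= derive1_chi.
Qed.

Lemma face_continuous : {within box au bu, continuous h}.
Proof.
apply/within_boxP => y yu e e0.
have yb : box a b (anchor c y).
  by rewrite -assemble_restr; apply/box_assemble; split => //; exact: box_restr.
have [r r0 rP] := (within_boxP _ _ _).1 fH1.1 _ yb e e0.
exists r => // y' yu' yy'; apply: rP.
  by rewrite -assemble_restr; apply/box_assemble; split => //; exact: box_restr.
move=> j; case: (index_inP u j) => [i ->|ju]; first by rewrite !anchor_in.
by rewrite !anchor_out// subrr normr0.
Qed.

Let slice_continuous y : box au bu y ->
  {within box ac bc, continuous (fun z => f (@assemble R d u (y, z)))}.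
Proof.
move=> yu; apply/within_boxP => z zc e e0.
have yzb : box a b (@assemble R d u (y, z)) by apply/box_assemble.
have [r r0 rP] := (within_boxP _ _ _).1 fH1.1 _ yzb e e0.
exists r => // z' zc' zz'; apply: rP; first exact/box_assemble.
apply: (@forall_setC _ u) => i; first by rewrite !assemble_in subrr normr0.
by rewrite !assemble_out.
Qed.

(** The peak in the frozen variables restricts f to the face. *)
Let step_limit (psi : 'rV[R]_#|u| -> R) : continuous psi ->
  \int[leb d]_(x in box a b)
    (f x * (psi (restr u x) * \prod_(j | j \notin u) eta k j (x ord0 j)))
    @[k --> \oo] -->
  \int[leb #|u|]_(y in box au bu) (h y * psi y).
Proof.
move=> cpsi; pose cc := restr (~: u) c.
have mBu := measurable_box au bu; have mBc := measurable_box ac bc.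
have mpsi : mbounded a b (fun x => psi (restr u x)).
  apply: mbounded_continuous => x.
  apply: (@continuous_comp _ _ _ (@restr R d u) psi); last exact: cpsi.
  exact: restr_continuous.
have mpsiu := mbounded_continuous au bu cpsi.
have mf : mbounded a b f by apply: mbounded_within; case: fH1.
have mF k : mbounded a b (fun x => f x * (psi (restr u x) *
    \prod_(j | j \notin u) eta k j (x ord0 j))).
  apply: mboundedM => //; apply: mboundedM => //; apply: mbounded_prod => j _.
  apply: mbounded_coord_continuous.
  exact/smooth1_derive1_continuous/smooth_s.
have ccbox : box ac bc cc by exact: box_restr.
have inner k y : box au bu y ->
    \int[leb #|~: u|]_(z in box ac bc) (f (assemble (y, z)) *
      (psi (restr u (assemble (y, z))) *
       \prod_(j | j \notin u) eta k j (assemble (y, z) ord0 j))) =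
    psi y * \int[leb #|~: u|]_(z in box ac bc)
      (f (assemble (y, z)) * peak ac bc cc k z).
  move=> yu; have mslice := mbounded_within (slice_continuous yu).
  rewrite -RintegralZl//; last first.
    apply: mbounded_integrable => //; apply: mboundedM => //.
    exact: mbounded_peak.
  apply: eq_Rintegral => z _; rewrite restr_assemble mulrCA; congr (_ * (_ * _)).
  rewrite /peak (eq_bigl (mem (~: u))); last by move=> j; rewrite /= inE.
  rewrite (big_enum_val (fun j => eta k j (@assemble R d u (y, z) ord0 j))).
  by apply: eq_bigr => i _; rewrite assemble_out !mxE.
have outer k := box_fubini u (mbounded_integrable abW (mF k)).
have E k : \int[leb d]_(x in box a b)
    (f x * (psi (restr u x) * \prod_(j | j \notin u) eta k j (x ord0 j))) =
  \int[leb #|u|]_(y in box au bu) (psi y *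
    \int[leb #|~: u|]_(z in box ac bc)
      (f (assemble (y, z)) * peak ac bc cc k z)).
  have [_ _ ->] := outer k; apply: eq_Rintegral => y; rewrite inE => yu.
  exact: inner.
under eq_fun do rewrite E.
have [_ [M fM]] := mf.
apply: (Rintegral_dominated (g := fun y => M * `|psi y|) mBu _ _ _ _).2.
- move=> k; have [_ /integrableP[/measurable_EFinP + _] _] := outer k.
  apply: eq_measurable_fun => y; rewrite inE => yu; exact: inner.
- move=> y yu; rewrite mulrC; apply: cvgMl_tmp.
  rewrite /h -assemble_restr.
  by apply: mollify => //; exact: slice_continuous.
- apply: mbounded_integrable => //; apply: mboundedM; first exact: mbounded_cst.
  apply: mbounded_continuous => y.
  apply: (@continuous_comp _ _ _ psi (fun t : R => `|t|)); first exact: cpsi.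
  exact: norm_continuous.
- move=> k y yu; rewrite normrM mulrC ler_wpM2r//.
  have mslice := mbounded_within (slice_continuous yu).
  have mpeak := @mbounded_peak _ _ ac bc cc k.
  have i1 := mbounded_integrable abcW (mboundedM mslice mpeak).
  apply: le_trans (le_normr_Rintegral mBc i1) _.
  have I1 : \int[leb #|~: u|]_(z in box ac bc) peak ac bc cc k z = 1.
    by rewrite /Rintegral integral_peak.
  rewrite -[leRHS]mulr1 -I1 -RintegralZl//; last exact: mbounded_integrable.
  apply: le_Rintegral => //.
  + exact: integrable_norm i1.
  + exact: mbounded_integrable (mboundedM (mbounded_cst _ _ M) mpeak).
  + move=> z zc; have p0 : 0 <= peak ac bc cc k z by exact: peak_ge0.
    rewrite normrM (ger0_norm p0) ler_wpM2r//; apply: fM; exact/box_assemble.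
Qed.

Lemma face_deriv_weak : is_weak_deriv au bu finset.setT h face_deriv.
Proof.
split; first exact: face_deriv_L2.
move=> phi tphi; have [sphi _ _] := tphi.
have cvW := @step_dominated phi tphi.
rewrite -(step_fubini tphi) in cvW.
have cvf := @step_limit _ (sphi (enum (finset.setT : {set 'I_#|u|}))).1.
have cvWf : \int[leb d]_(x in box a b) (phi (restr u x) * Wk k x) @[k --> \oo]
    --> (-1) ^+ #|u| * \int[leb #|u|]_(y in box au bu)
        (h y * iter_partial (enum (finset.setT : {set 'I_#|u|})) phi y).
  under eq_fun do rewrite step_weak//.
  exact: cvgMl_tmp.
have := cvg_unique _ cvW cvWf => ->//.
by rewrite cardsT card_ord mulrA -exprD addnn -mul2n exprM sqrrN !expr1n mul1r.
Qed.

End face_derivative.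

(** * Uniqueness of weak derivatives *)

Section open_rays.
Context {R : realType} {n : nat}.

(** A system of generators that is stable under intersection. Bounds in the
    extended reals let a coordinate be unconstrained. *)
Definition above (p : 'I_n -> \bar R) : set 'rV[R]_n :=
  [set x | forall j, (p j < (x ord0 j)%:E)%E].

Definition aboves : set (set 'rV[R]_n) := [set X | exists p, X = above p].

Lemma aboves_setI : setI_closed aboves.
Proof.
move=> _ _ [p ->] [q ->]; exists (fun j => Order.max (p j) (q j)).
apply/seteqP; split => x /= => [[px qx] j|H].
  by rewrite gt_max px qx.
by split => j; have := H j; rewrite gt_max => /andP[].
Qed.

Lemma above_setT : above (fun=> -oo%E) = setT.
Proof. by apply/seteqP; split => // x _ j; rewrite ltNyr. Qed.

Lemma measurable_above p : measurable (above p).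
Proof.
rewrite (_ : above p = rect (fun j => [set t | (p j < t%:E)%E])).
  apply: measurable_rect => j.
  case: (p j) => [r||].
  - rewrite (_ : mkset _ = `]r, +oo[%classic); first exact: measurable_itv.
    by apply/seteqP; split => t; rewrite /= in_itv/= lte_fin andbT.
  - by rewrite (_ : mkset _ = set0)//; apply/seteqP; split => t //=; rewrite ltNge leey.
  - by rewrite (_ : mkset _ = setT)//; apply/seteqP; split => t //= _; rewrite ltNyr.
by apply/seteqP; split.
Qed.

Lemma measurable_aboves : @measurable _ 'rV[R]_n = <<s aboves >>.
Proof.
apply/seteqP; split; last first.
  apply: smallest_sub; first exact: sigma_algebra_measurable.
  by move=> _ [p ->]; exact: measurable_above.
apply: smallest_sub; first exact: smallest_sigma_algebra.
move=> X; rewrite -bigcup_seq => -[j _ [Y mY <-]].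
have mj : measurable_fun (setT : set (g_sigma_algebraType aboves))
    ((fun x : 'rV[R]_n => x ord0 j) : g_sigma_algebraType aboves -> measurableTypeR R).
  apply: (measurability (RGenOInfty.G (R := R)) (RGenOInfty.measurableE R)).
  move=> _ [_ [r ->] <-]; apply: sub_sigma_algebra.
  exists (fun i => if i == j then r%:E else -oo%E).
  rewrite setTI; apply/seteqP; split => x /=; rewrite in_itv/= andbT.
    by move=> rx i; case: eqP => [->|_]; rewrite ?lte_fin// ltNyr.
  by move=> /(_ j); rewrite eqxx lte_fin.
exact: (mj measurableT Y mY).
Qed.

End open_rays.

Section uniqueness.
Context {R : realType} {n : nat}.
Variables a b : 'rV[R]_n.
Hypothesis ab : forall j, a ord0 j < b ord0 j.

Notation leb := (lebesgue_rV (R := R) n).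

Let abW j : a ord0 j <= b ord0 j. Proof. exact: ltW. Qed.

Lemma open_boxE :
  open_box a b = rect (fun j => `]a ord0 j, b ord0 j[%classic).
Proof. by apply/seteqP; split => x H j; have := H j; rewrite /= in_itv. Qed.

Lemma measurable_open_box : measurable (open_box a b).
Proof. by rewrite open_boxE; apply: measurable_rect => j; exact: measurable_itv. Qed.

(** Test functions see only the open box, whereas norms are taken over the
    closed one. *)
Lemma boundary_box_null : leb (box a b `\` open_box a b) = 0%E.
Proof.
have mB := measurable_box a b; have mO := measurable_open_box.
rewrite measureD//; last by rewrite [ltLHS]lebesgue_rV_box// ltry.
rewrite setIidr; last exact: open_box_box.
rewrite [X in (X - _)%E]lebesgue_rV_box// open_boxE [X in (_ - X)%E]lebesgue_rV_rect.
  rewrite (eq_bigr (fun j => (b ord0 j - a ord0 j)%:E)).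
    by rewrite prodEFin subee.
  by move=> j _; rewrite lebesgue_measure_itv/= lte_fin ab EFinB.
by move=> j; exact: measurable_itv.
Qed.

Variable g : 'rV[R]_n -> R.
Hypothesis gL : L2_on a b g.
Hypothesis g0 : forall phi, test_function a b phi ->
  \int[leb]_(x in box a b) (g x * phi x) = 0.

Let ig : leb.-integrable (box a b) (EFin \o g).
Proof. exact: L2_integrable. Qed.

Let igA A : measurable A -> leb.-integrable (A `&` open_box a b) (EFin \o g).
Proof.
move=> mA; apply: (integrableS (measurable_box a b) _ _ ig).
  by apply: measurableI => //; exact: measurable_open_box.
by apply: subset_trans (@open_box_box _ _ a b); exact: subIsetr.
Qed.

(** The indicator of the intersection is the pointwise limit of products of
    jump differences from p' to b, where p' is p moved into the box. *)
Let orthogonal_above p :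
  \int[leb]_(x in above p `&` open_box a b) g x = 0.
Proof.
have mB := measurable_box a b.
(* Truncation of p to the box; the three cases avoid infinite values. *)
pose p' : 'rV[R]_n := \row_j
  (if (p j <= (a ord0 j)%:E)%E then a ord0 j
   else if ((b ord0 j)%:E <= p j)%E then b ord0 j else fine (p j)).
have p'E j t : (p' ord0 j < t < b ord0 j) =
    ((p j < t%:E)%E && (a ord0 j < t < b ord0 j)).
  have abj := ab j; rewrite mxE; case: (p j) => [r||].
  - rewrite !lee_fin lte_fin /=; case: (leP r (a ord0 j)) => ra.
      by case: (ltP r t) => //= tr; apply/negbTE/negP => /andP[? ?]; lra.
    case: (leP (b ord0 j) r) => br.
      by rewrite lt_asym; apply/esym/negbTE/negP => /and3P[? ? ?]; lra.
    by case: (ltP r t) => //= rt; rewrite (lt_trans ra rt).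
  - by rewrite leye_eq /= leey lt_asym ?ltNge ?leey.
  - by rewrite leNye ltNyr.
have p'box : box a b p'.
  move=> j; have abj := ab j; rewrite mxE; case: (p j) => [r||].
  - rewrite !lee_fin /=; case: (leP r (a ord0 j)) => ra; first by rewrite lexx ltW.
    by case: (leP (b ord0 j) r) => br; rewrite ?lexx !ltW.
  - by rewrite leye_eq /= leey lexx ltW.
  - by rewrite leNye lexx ltW.
have bbox : box a b b by move=> j; rewrite abW lexx.
pose lim1 (x : 'rV[R]_n) : R :=
  \prod_j (jump_lim (a ord0 j) (b ord0 j) (p' ord0 j) (x ord0 j) -
           jump_lim (a ord0 j) (b ord0 j) (b ord0 j) (x ord0 j)).
have lim1j j t : jump_lim (a ord0 j) (b ord0 j) (p' ord0 j) t -
    jump_lim (a ord0 j) (b ord0 j) (b ord0 j) t = ((p' ord0 j < t < b ord0 j)%R : bool)%:R.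
  have /andP[_ pb] := p'box j.
  rewrite /jump_lim ltxx; have [pb'|pb'] := ltP (p' ord0 j) (b ord0 j).
    have [pt|pt] := ltP (p' ord0 j) t; have [tb|tb] := ltP t (b ord0 j);
      rewrite ?subr0 ?subrr//=.
    by exfalso; lra.
  rewrite subrr; have [pt|//] := ltP (p' ord0 j) t.
  by have [tb|//] := ltP t (b ord0 j); exfalso; lra.
have lim1E x : lim1 x = ((x \in above p `&` open_box a b) : bool)%:R.
  rewrite /lim1; under eq_bigr do rewrite lim1j p'E.
  case: (boolP (x \in _)) => [|xN].
    rewrite inE => -[px xO]; rewrite big1// => j _.
    by rewrite (px j) (xO j).
  have /existsNP[j xj] : ~ forall j, (p j < (x ord0 j)%:E)%E &&
      (a ord0 j < x ord0 j < b ord0 j).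
    move=> H; move: xN; rewrite notin_setE; apply; split => j;
    by have /andP[] := H j.
  by rewrite (bigD1 j)//= (negbTE (introN idP xj)) mul0r.
have zero k : \int[leb]_(x in box a b)
    (g x * \prod_j jump_diff a b p' b k j (x ord0 j)) = 0.
  have [tf _] := test_prod (smooth1_jump_diff a b p' b k) (jump_diff_margin ab p'box bbox k).
  exact: g0.
have [mg _] := (L2_onP a b g).1 gL.
have cv : \int[leb]_(x in box a b)
    (g x * \prod_j jump_diff a b p' b k j (x ord0 j)) @[k --> \oo] -->
    \int[leb]_(x in box a b) (g x * lim1 x).
  apply: (Rintegral_dominated (g := fun x => `|g x|) mB _ _ _ _).2.
  - move=> k; apply: measurable_funM => //; apply: measurable_funTS.
    apply: (@measurable_prod_coord _ _ (jump_diff a b p' b k)) => j.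
    apply: continuous_measurable_fun; apply: smooth1_continuous.
    exact: smooth1_jump_diff.
  - move=> x _; apply: cvgMl_tmp; apply: cvg_prodr => j _.
    by apply: cvgB; exact: jump_cvg.
  - exact: integrable_norm.
  - move=> k x _; rewrite normrM ler_piMr// normr_prod.
    by apply: prodr_ile1 => j _; rewrite normr_ge0 jump_diff_le1.
have z0 : \int[leb]_(x in box a b) (g x * lim1 x) = 0.
  by apply: (cvg_unique _ cv) => //; apply: cvg_near_cst; exact: nearW.
rewrite -z0 -{1}(setIidl (@open_box_box _ _ a b)) setIA setIC Rintegral_mkcondr.
apply: eq_Rintegral => x _; rewrite lim1E patchE.
by case: ifP => _; rewrite ?mulr1 ?mulr0.
Qed.

(** The sets with this property form a Dynkin system that contains the
    generators. *)
Lemma orthogonal_open_box A : measurable A ->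
  \int[leb]_(x in A `&` open_box a b) g x = 0.
Proof.
have mO := measurable_open_box.
have all0 : \int[leb]_(x in setT `&` open_box a b) g x = 0.
  by rewrite -above_setT; exact: orthogonal_above.
move=> mA; rewrite measurable_aboves in mA.
apply: (dynkin_induction (P := fun A => \int[leb]_(x in A `&` open_box a b) g x = 0)
  measurable_aboves aboves_setI _ _ _ _ mA) => //.
- by move=> _ [p ->]; exact: orthogonal_above.
- move=> S mS S0.
  have := @Rintegral_setU _ _ _ leb (S `&` open_box a b) (~` S `&` open_box a b) g.
  rewrite -setIUl setUv S0 add0r all0 => <- //.
  + exact: measurableI.
  + by apply: measurableI => //; exact: measurableC.
  + exact: igA.
  + by apply/disj_set2P/seteqP; split => // x [[Sx _] [nSx _]].
- move=> F mF tF F0; rewrite setI_bigcupl /Rintegral integral_bigcup//.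
  + rewrite eseries0// => k _ _.
    have fin := integrable_fin_num (measurableI _ _ (mF k) mO) (igA (mF k)).
    by rewrite -(fineK fin); congr EFin; exact: F0.
  + exact: trivIset_setIr.
  + by move=> k; exact: measurableI.
  + by rewrite -setI_bigcupl; apply: igA; exact: bigcup_measurable.
Qed.

Lemma orthogonal_ae0 : {ae leb, forall x, box a b x -> g x = 0}.
Proof.
have mB := measurable_box a b; have mO := measurable_open_box.
have iO : leb.-integrable (open_box a b) (EFin \o g).
  by rewrite -(setTI (open_box a b)); exact: igA.
have aeO : ae_eq leb (open_box a b) (EFin \o g) (cst 0%E).
  apply: integral_ae_eq => // E EO mE.
  rewrite integral0 -(setIidl EO).
  have fin := integrable_fin_num (measurableI _ _ mE mO) (igA mE).
  by rewrite -(fineK fin); congr EFin; exact: orthogonal_open_box.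
have aeB : {ae leb, forall x, ~ (box a b `\` open_box a b) x}.
  exists (box a b `\` open_box a b); split.
  - exact: measurableD.
  - exact: boundary_box_null.
  - by move=> x /= /contrapT.
apply: filterS2 aeO aeB => x gx xN xB.
have [xO|xO] := pselect (open_box a b x); last by case: xN.
by have [] := gx xO.
Qed.

End uniqueness.

Lemma weak_deriv_unique (R : realType) n (a b : 'rV[R]_n) u f g1 g2 :
  (forall j, a ord0 j < b ord0 j) ->
  is_weak_deriv a b u f g1 -> is_weak_deriv a b u f g2 ->
  L2norm a b g1 = L2norm a b g2.
Proof.
move=> ab [L1 W1] [L2 W2].
have abW j : a ord0 j <= b ord0 j by exact: ltW.
have mB := measurable_box a b.
have [mg1 _] := (L2_onP a b g1).1 L1; have [mg2 _] := (L2_onP a b g2).1 L2.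
have L12 : L2_on a b (fun x => g1 x + -1 * g2 x).
  by apply: L2_onD => //; apply: L2_onM => //; exact: mbounded_cst.
have := orthogonal_ae0 ab L12.
move=> /(_ _)/wrap[].
  move=> phi tphi; have [sphi _ _] := tphi.
  have mphi := mbounded_continuous a b (sphi [::]).1.
  have i1 := mboundedM_integrable abW mphi L1.
  have i2 := mboundedM_integrable abW mphi L2.
  transitivity (\int[lebesgue_rV n]_(x in box a b) (phi x * g1 x - phi x * g2 x)).
    by apply: eq_Rintegral => x _; ring.
  rewrite RintegralB//; apply/eqP; rewrite subr_eq0; apply/eqP.
  apply: (@mulrI _ ((-1) ^+ #|u|)); first by rewrite unitrX// unitrN unitr1.
  have := W1 _ tphi; rewrite W2//.
  under eq_Rintegral do rewrite mulrC.
  by under [in RHS]eq_Rintegral do rewrite mulrC; move=> ->.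
move=> ae0; rewrite !L2normE; congr (_ `^ _)%E.
apply: ae_eq_integral => //.
- by apply/measurable_EFinP; exact: measurable_funX.
- by apply/measurable_EFinP; exact: measurable_funX.
- by apply: filterS ae0 => x H /H; rewrite mulN1r => /subr0_eq ->.
Qed.

(** * The embedding constant and the constant function *)

Section constant_one.
Context {R : realType}.

Lemma rV_insert_shift n (j : 'I_n.+1) (x : 'rV[R]_n) (s t : R) :
  rV_insert j (x, s + t) = s *: delta_mx ord0 j + rV_insert j (x, t).
Proof.
apply/rowP => i; rewrite !mxE eqxx /=; case: unliftP => [k ->|->] /=.
  by rewrite (_ : lift j k == j = false) ?mulr0 ?add0r// eq_sym (negbTE (neq_lift _ _)).
by rewrite eqxx mulr1.
Qed.

(** Fubini's theorem with the variable j innermost, and the fundamental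
    theorem of calculus: a test function vanishes at both ends. *)
Lemma integral_partial_test n (a b : 'rV[R]_n) phi s j :
  (forall j, a ord0 j < b ord0 j) -> test_function a b phi ->
  \int[lebesgue_rV n]_(x in box a b) partial j (iter_partial s phi) x = 0.
Proof.
case: n => [|n] in a b phi s j *; first by case: j.
move=> ab tphi; have [sphi _ _] := tphi.
have mB := measurable_box a b; set psi := iter_partial s phi.
have abW k : a ord0 k <= b ord0 k by exact: ltW.
have out x : ~ open_box a b x -> psi x = 0.
  exact: test_function_eq0 tphi.
have dout x : ~ open_box a b x -> partial j psi x = 0.
  exact: (@test_function_eq0 _ _ a b phi (j :: s) x tphi).
have cdpsi : continuous (partial j psi) := (sphi (j :: s)).1.
have cpsi : continuous psi := (sphi s).1.
have dE : (partial j psi) \_ (box a b) = partial j psi.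
  apply/funext => x; rewrite patchE; case: ifPn => // xN.
  rewrite dout// => /(@open_box_box _ _ a b) xB.
  by move: xN; rewrite notin_setE.
have ipsi : (lebesgue_rV n.+1).-integrable setT (EFin \o partial j psi).
  rewrite -dE -restrict_EFin; apply/integrable_restrict => //.
  rewrite setTI; apply: mbounded_integrable => //.
  exact: mbounded_continuous.
rewrite Rintegral_mkcond dE.
have [_ _ ->] := split_fubini (split_rV_insert j) ipsi.
have inner (x : 'rV[R]_n) :
    \int[lebesgue_measure]_t partial j psi (rV_insert j (x, t)) = 0.
  have insj t : rV_insert j (x, t) ord0 j = t by rewrite mxE unlift_none.
  have cins : continuous (fun t : R => rV_insert j (x, t)).
    move=> t A /nbhs_ballP[e /= e0 eA]; apply/nbhs_ballP.
    exists e => //= t' tt'; apply: eA; split => // i k; rewrite !mxE.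
    by case: unliftP => [l _|_] /=; [exact: ballxx|exact: tt'].
  (* The restriction of psi to the line through x in direction j. *)
  pose theta (t : R) := psi (rV_insert j (x, t)).
  have dtheta t : is_derive t (1 : R) theta (partial j psi (rV_insert j (x, t))).
    have dpsi := (sphi s).2 j (rV_insert j (x, t)).
    suff cv : h^-1 *: ((theta \o shift t) (h *: (1 : R)) - theta t) @[h --> 0^']
        --> partial j psi (rV_insert j (x, t)).
      by apply: DeriveDef; [apply/cvg_ex; eexists; exact: cv|exact: cvg_lim].
    rewrite (_ : (fun _ => _) = fun h => h^-1 *: ((psi \o shift (rV_insert j (x, t)))
        (h *: delta_mx ord0 j) - psi (rV_insert j (x, t)))); first exact: dpsi.
    apply/funext => h; rewrite /theta /= -rV_insert_shift.
    by rewrite /GRing.scale/= mulr1.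
  have ctheta : continuous theta.
    move=> t; apply: (@continuous_comp _ _ _ (fun t : R => rV_insert j (x, t)) psi).
      exact: cins.
    exact: cpsi.
  have bnd t : ~ (a ord0 j < t < b ord0 j) ->
      theta t = 0 /\ partial j psi (rV_insert j (x, t)) = 0.
    move=> tN; have xN : ~ open_box a b (rV_insert j (x, t)).
      by move=> /(_ j); rewrite insj.
    by split; [exact: out|exact: dout].
  have -> : \int[lebesgue_measure]_t partial j psi (rV_insert j (x, t)) =
      \int[lebesgue_measure]_(t in `[a ord0 j, b ord0 j])
        partial j psi (rV_insert j (x, t)).
    rewrite [RHS]Rintegral_mkcond; apply: eq_Rintegral => t _.
    rewrite patchE; case: ifPn => // tN; apply: (bnd t _).2.
    move=> /andP[t1 t2]; move: tN; rewrite notin_setE; apply.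
    by rewrite /= in_itv/= !ltW.
  rewrite /Rintegral (@continuous_FTC2 _ _ theta) ?ab//.
  - rewrite (bnd (a ord0 j) _).1 ?(bnd (b ord0 j) _).1 ?subee//;
      by rewrite ltxx ?andbF.
  - apply: continuous_subspaceT => t.
    apply: (@continuous_comp _ _ _ (fun t : R => rV_insert j (x, t))
      (partial j psi)); [exact: cins|exact: cdpsi].
  - split.
    + by move=> t _; have [] := dtheta t.
    + exact/cvg_at_right_filter/ctheta.
    + exact/cvg_at_left_filter/ctheta.
  - by move=> t _; have dt := dtheta t; rewrite derive1E derive_val.
under eq_Rintegral do rewrite inner.
by rewrite Rintegral_cst// mul0r.
Qed.

Section box.
Context {n : nat}.
Variables a b : 'rV[R]_n.
Hypothesis ab : forall j, a ord0 j < b ord0 j.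

Let abW j : a ord0 j <= b ord0 j. Proof. exact: ltW. Qed.

(** The mixed derivatives of the constant 1 vanish. *)
Lemma weak_deriv_one u :
  is_weak_deriv a b u (fun=> 1) (fun=> if u == finset.set0 then 1 else 0).
Proof.
split; first exact: L2_on_cst.
move=> phi tphi; have [->|u0] := eqVneq u finset.set0.
  rewrite (_ : enum _ = [::]) ?cards0 ?expr0 ?mul1r//.
  by apply/size0nil; rewrite -cardE cards0.
case E : (enum u) => [|j s].
  by move/(congr1 size): E; rewrite -cardE => /eqP; rewrite cards_eq0 (negbTE u0).
under eq_Rintegral do rewrite mul1r.
under [in RHS]eq_Rintegral do rewrite mul0r.
rewrite (integral_partial_test s j ab tphi).
by rewrite Rintegral_cst ?mul0r ?mulr0//; exact: measurable_box.
Qed.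

Let vol : R := \prod_j (b ord0 j - a ord0 j).

Let vol_gt0 : 0 < vol.
Proof. by apply: prodr_gt0 => j _; rewrite subr_gt0. Qed.

Lemma H1mix_one : H1mix a b (fun=> 1).
Proof.
split; first exact/continuous_subspaceT/cst_continuous.
by move=> u; eexists; exact: weak_deriv_one.
Qed.

Lemma H1mix_norm_one : H1mix_norm a b (fun=> 1) = (vol `^ 2^-1)%:E.
Proof.
have L2cst (k : R) : L2norm a b (fun=> k) = ((k ^+ 2 * vol) `^ 2^-1)%:E.
  rewrite L2normE (integral_cst _ (measurable_box a b) (k ^+ 2)%:E).
  by rewrite [X in (_ * X)%E]lebesgue_rV_box// -EFinM poweR_EFin.
have wE u : L2norm a b (weak_deriv a b u (fun=> 1)) =
    (((if u == finset.set0 then 1 else 0) ^+ 2 * vol) `^ 2^-1)%:E.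
  rewrite -L2cst; apply: (@weak_deriv_unique _ _ _ _ u (fun=> 1)) => //.
    by apply: xgetPex; eexists; exact: weak_deriv_one.
  exact: weak_deriv_one.
rewrite /H1mix_norm (bigD1 finset.set0)//= big1 ?adde0 => [|u /negbTE u0].
  have sq : (vol `^ 2^-1) `^ 2 = vol.
    by rewrite -powRrM mulVf ?pnatr_eq0// powRr1// ltW.
  by rewrite wE eqxx expr1n mul1r !poweR_EFin sq.
rewrite wE u0 expr0n mul0r powR0 ?invr_eq0 ?pnatr_eq0//.
by rewrite poweR_EFin powR0// pnatr_eq0.
Qed.

(** An essential supremum below 1 would make the box negligible. *)
Lemma Linfnorm_one_ge : (1 <= Linfnorm a b (fun=> 1%R))%E.
Proof.
have mB := measurable_box a b.
have vB : (0 < lebesgue_rV n (box a b))%E.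
  by rewrite lebesgue_rV_box// lte_fin.
have vT : (0 < lebesgue_rV (R := R) n setT)%E.
  by apply: (lt_le_trans vB _); apply: le_measure; rewrite ?inE.
rewrite /Linfnorm unlock /Lnorm vT leNgt; apply/negP => lt1.
have := ess_sup_ge (lebesgue_rV n)
  (abse \o (EFin \o (((fun=> 1) : 'rV[R]_n -> R) \_ (box a b)))).
move=> [N [mN N0 subN]].
have BN : box a b `<=` N.
  move=> x xB; apply: subN => /=.
  rewrite patchE mem_set//= normr1 => H.
  by have := le_lt_trans H lt1; rewrite ltxx.
have : (lebesgue_rV n (box a b) <= lebesgue_rV n N)%E.
  by apply: le_measure; rewrite ?inE.
by rewrite N0 leNgt vB.
Qed.

(** The embedding inequality for the function 1, whose norm in H^1_mix is the
    square root of the volume. *)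
Lemma embedding_constant_ge C : embedding_constant a b C ->
  1 <= C * vol `^ 2^-1.
Proof.
move=> /(_ _ H1mix_one); rewrite H1mix_norm_one -EFinM => H.
by rewrite -lee_fin (le_trans Linfnorm_one_ge).
Qed.

End box.

End constant_one.

(** * Anchored components *)

Section components.
Context {R : realType} {d : nat}.
Variables (a b c : 'rV[R]_d) (f : 'rV[R]_d -> R).

(** Inclusion-exclusion: the sum is the expansion of a product of factors 1 -
    1, indexed by the complement of v. *)
Lemma sum_signed_supersets (v : {set 'I_d}) :
  \sum_(u : {set 'I_d} | v \subset u) (-1) ^+ (#|u| - #|v|) =
  (v == finset.setT)%:R :> R.
Proof.
have -> : (v == finset.setT)%:R = \prod_(i in ~: v) (1 - 1) :> R.
  case: eqVneq => [->|vT]; first by rewrite finset.setCT big_set0.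
  have /fintype.subsetPn[j _ jv] : ~~ (finset.setT \subset v).
    by rewrite finset.subTset.
  by rewrite (bigD1 j) ?inE//= subrr mul0r.
rewrite prodrB_subsets_in.
rewrite (reindex_onto (fun J => v :|: J) (fun u => u :\: v))/=; last first.
  move=> u vu; apply/finset.setP => j; rewrite !inE.
  by case: (boolP (j \in v)) => //= /(fintype.subsetP vu) ->.
have UvE (J : {set 'I_d}) : (v :|: J) :\: v = J :\: v.
  by apply/finset.setP => j; rewrite !inE; case: (j \in v).
apply: eq_big => [J|J /andP[_ /eqP Jv]].
  rewrite finset.subsetUl UvE -finset.disjoints_subset.
  by rewrite (sameP eqP finset.setDidPl).
have Jdisj : [disjoint v & J]%bool.
  rewrite disjoint_sym finset.disjoints_subset -Jv.
  by apply/fintype.subsetP => j; rewrite !inE => /andP[].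
have /eqP -> : #|v :|: J| == (#|v| + #|J|)%N.
  by rewrite (finset.leq_card_setU v J).2.
by rewrite addKn big1 ?mulr1// => i _; case: ifP.
Qed.

Lemma anchored_decomposition x :
  f x = \sum_(u : {set 'I_d}) anchored_component c f u x.
Proof.
rewrite /anchored_component (exchange_big_dep predT)//=.
under eq_bigr => v _ do rewrite -mulr_suml sum_signed_supersets.
rewrite (bigD1 finset.setT)//= eqxx mul1r big1 ?addr0; last first.
  by move=> v /negbTE ->; rewrite mul0r.
by congr f; apply/rowP => j; rewrite anchorE inE.
Qed.

Lemma anchored_error (L : {set {set 'I_d}}) x :
  f x - anchored_sum c f L x =
  \sum_(u in ~: L) anchored_component c f u x.
Proof.
rewrite {1}(anchored_decomposition x) (bigID (mem L))/= addrC addrK.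
by apply: eq_bigl => u; rewrite inE.
Qed.

(** Subsets of u correspond to sets of coordinates of R^#|u|, and f((x;c)_v)
    is the value of the section at the vertex that takes its coordinates in v
    from x. *)
Lemma anchored_component_vertex u x :
  `|anchored_component c f u x| =
  `|\sum_(J : {set 'I_#|u|}) (-1) ^+ #|J| *
     f (anchor c (vertex (restr u c) (restr u x) J))|.
Proof.
rewrite /anchored_component.
rewrite (reindex_onto (fun J : {set 'I_#|u|} => enum_val @: J)
  (fun v => enum_val @^-1: v))/=; last first.
  move=> v vu; apply/setP => j; apply/imsetP/idP => [[i]|jv].
    by rewrite inE => iv ->.
  have ju := fintype.subsetP vu _ jv.
  by exists (enum_rank_in ju j); rewrite ?inE enum_rankK_in.
rewrite (eq_big predT (fun J : {set 'I_#|u|} => (-1) ^+ #|u| * ((-1) ^+ #|J| *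
     f (anchor c (vertex (restr u c) (restr u x) J))))).
- by rewrite -mulr_sumr normrM normrX normrN1 expr1n mul1r.
- move=> J; apply/andP; split.
    by apply/fintype.subsetP => j /imsetP[i _ ->]; exact: enum_valP.
  apply/eqP/setP => i; rewrite inE mem_imset//; exact: enum_val_inj.
- move=> J /andP[Ju _]; rewrite mulrA; congr (_ * f _).
    rewrite card_imset; last exact: enum_val_inj.
    have Jle : (#|J| <= #|u|)%N.
      by rewrite (leq_trans (max_card _))// card_ord.
    exact: signr_subn.
  apply/rowP => j; rewrite anchorE; case: (index_inP u j) => [i ->|ju].
    rewrite anchor_in !mxE mem_imset//; exact: enum_val_inj.
  rewrite anchor_out// ifF//; apply/negbTE/negP => /imsetP[i _ ji].
  by move: ju; rewrite ji enum_valP.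
Qed.

Hypothesis ab : forall j, a ord0 j < b ord0 j.
Hypothesis abc : box a b c.
Hypothesis fH1 : H1mix a b f.

Let side (u : {set 'I_d}) : R := \prod_(j in u) (b ord0 j - a ord0 j).

(** For nonempty u, [vertex_bound] applies to the section and to the weak
    derivative that defines its norm, which exists by [face_deriv_weak]. *)
Lemma component_bound u x : box a b x ->
  (`|anchored_component c f u x|%:E <=
   face_norm a b c f u * ((side u) `^ 2^-1)%:E)%E.
Proof.
move=> xab; rewrite /face_norm; case: eqVneq => [->|u0].
  rewrite /side big_set0 powR1 mule1 lee_fin /anchored_component.
  rewrite (big_pred1 finset.set0); last by move=> v; rewrite finset.subset0.
  rewrite subnn expr0 mul1r (_ : anchor c _ = c)//.
  by apply/rowP => j; rewrite anchorE inE.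
rewrite anchored_component_vertex.
have wP : is_weak_deriv (restr u a) (restr u b) finset.setT
    (fun y => f (anchor c y))
    (weak_deriv (restr u a) (restr u b) finset.setT (fun y => f (anchor c y))).
  by apply: xgetPex; eexists; exact: (face_deriv_weak u ab abc fH1).
have := vertex_bound (restr_lt ab (v := u)) (box_restr (v := u) abc)
  (box_restr (v := u) xab) (face_continuous (u := u) abc fH1) wP.
rewrite (_ : \prod_j _ = side u)// /side (big_enum_val (fun j => b ord0 j - a ord0 j)).
by apply: eq_bigr => j _; rewrite !mxE.
Qed.

Lemma face_norm_fin u : face_norm a b c f u \is a fin_num.
Proof.
rewrite /face_norm; case: ifP => // _; apply: L2norm_fin.
have [] : is_weak_deriv (restr u a) (restr u b) finset.setT
    (fun y => f (anchor c y))
    (weak_deriv (restr u a) (restr u b) finset.setT (fun y => f (anchor c y))).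
  by apply: xgetPex; eexists; exact: (face_deriv_weak u ab abc fH1).
by [].
Qed.

Lemma face_norm_ge0 u : (0 <= face_norm a b c f u)%E.
Proof. by rewrite /face_norm; case: ifP => _; rewrite ?lee_fin// L2normE poweR_ge0. Qed.

Section weighted.
Variable gamma : {set 'I_d} -> R.
Hypothesis gamma_gt0 : forall u, 0 < gamma u.

Let N u := fine (face_norm a b c f u).

Let N_ge0 u : 0 <= N u. Proof. exact/fine_ge0/face_norm_ge0. Qed.

Let A : R := (\sum_(u : {set 'I_d}) (gamma u)^-1 * N u ^+ 2) `^ 2^-1.

Lemma anchored_normE : anchored_norm a b c gamma f = A%:E.
Proof.
rewrite /anchored_norm /A -poweR_EFin -sumEFin; congr (_ `^ _)%E.
apply: eq_bigr => u _; rewrite EFinM -(fineK (face_norm_fin u)) -/(N u).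
by rewrite poweR_EFin powR_mulrn.
Qed.

Let term_ge0 u : 0 <= (gamma u)^-1 * N u ^+ 2.
Proof. by rewrite mulr_ge0 ?sqr_ge0// invr_ge0 ltW. Qed.

Lemma face_norm_le u : N u <= (gamma u) `^ 2^-1 * A.
Proof.
have g0 := gamma_gt0 u.
rewrite /A -powRM ?sumr_ge0//; last exact: ltW.
have -> : N u = (N u ^+ 2) `^ 2^-1.
  by rewrite -powR_mulrn// -powRrM mulfV ?pnatr_eq0// powRr1.
set S := \sum_(u : {set 'I_d}) _.
have S0 : 0 <= S by exact: sumr_ge0.
apply: ge0_ler_powR; first by rewrite invr_ge0.
- by rewrite nnegrE sqr_ge0.
- by rewrite nnegrE mulr_ge0// ltW.
rewrite /S (bigD1 u)//= mulrDr mulrA mulfV ?gt_eqF// mul1r lerDl.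
by rewrite mulr_ge0 ?sumr_ge0// ltW.
Qed.

Lemma Linfnorm_le (g : 'rV[R]_d -> R) (M : R) : 0 <= M ->
  (forall x, box a b x -> `|g x| <= M) -> (Linfnorm a b g <= M%:E)%E.
Proof.
move=> M0 gM; rewrite /Linfnorm unlock /Lnorm; case: ifP => _; last first.
  by rewrite lee_fin.
apply/ess_supP; apply/nearW => x /=; rewrite patchE.
by case: ifPn => [|_]; rewrite lee_fin ?normr0// inE => /gM.
Qed.

(** The two bounds of the theorem are the choices k = Ktilde and k = 2^{#u/2},
    with gamma_u^{1/2} taken from [face_norm_le]. *)
Lemma error_bound (Cemb : R) (k : {set 'I_d} -> R) (L : {set {set 'I_d}}) :
  (forall u, (side u) `^ 2^-1 <= Cemb * k u) ->
  (Linfnorm a b (fun x => (f x - anchored_sum c f L x)%R) <=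
   (Cemb * \sum_(u in ~: L) k u * (gamma u) `^ 2^-1)%R%:E *
   anchored_norm a b c gamma f)%E.
Proof.
move=> kP; rewrite anchored_normE -EFinM.
have bnd x : box a b x -> `|f x - anchored_sum c f L x| <=
    Cemb * (\sum_(u in ~: L) k u * gamma u `^ 2^-1) * A.
  move=> xab; rewrite anchored_error (le_trans (ler_norm_sum _ _ _))//.
  rewrite mulr_sumr mulr_suml; apply: ler_sum => u _.
  apply: (@le_trans _ _ (N u * side u `^ 2^-1)).
    rewrite -lee_fin EFinM fineK ?face_norm_fin//; exact: component_bound.
  rewrite mulrA mulrC -mulrA; apply: ler_pM; rewrite ?powR_ge0//.
  exact: face_norm_le.
apply: Linfnorm_le => //.
by apply: le_trans (bnd c abc); exact: normr_ge0.
Qed.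

End weighted.

End components.

Theorem corollary3p7 (R : realType) (d : nat) (a b c : 'rV[R]_d)
    (gamma : {set 'I_d} -> R) (Cemb : R)
    (d_gt0 : (0 < d)%N)
    (ab : forall j, a ord0 j < b ord0 j)
    (abc : box a b c)
    (gamma_gt0 : forall u, 0 < gamma u)
    (embC : embedding_constant a b Cemb)
    (f : 'rV[R]_d -> R) (fH1 : H1mix a b f)
    (Lambda : {set {set 'I_d}}) (LambdaP : downward_closed Lambda) :
  (Linfnorm a b (fun x => (f x - anchored_sum c f Lambda x)%R)
    <= (Cemb * \sum_(u in ~: Lambda) Ktilde a b u * (gamma u) `^ 2^-1)%R%:E
       * anchored_norm a b c gamma f)%E
  /\
  ((forall j, 0 <= b ord0 j - a ord0 j <= 1) ->
   (Linfnorm a b (fun x => (f x - anchored_sum c f Lambda x)%R)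
     <= (Cemb * \sum_(u in ~: Lambda) 2 `^ (#|u|%:R / 2) * (gamma u) `^ 2^-1)%R%:E
        * anchored_norm a b c gamma f)%E).
Proof.
have len_gt0 j : 0 < b ord0 j - a ord0 j by rewrite subr_gt0.
have C1 := embedding_constant_ge ab embC.
have C0 : 0 <= Cemb.
  rewrite leNgt; apply/negP => Cneg.
  have := le_trans C1 (mulr_le0_ge0 (ltW Cneg) (powR_ge0 _ _)).
  by rewrite ler10.
pose V (A : {set 'I_d}) : R := \prod_(j in A) (b ord0 j - a ord0 j).
have V0 A : 0 <= V A by apply: prodr_ge0 => j _; exact: ltW.
have two1 (u : {set 'I_d}) : 1 <= 2 `^ (#|u|%:R / 2) :> R.
  rewrite -[leLHS](powRr0 2); apply: ler_powR; first by rewrite ler1n.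
  by rewrite divr_ge0.
(* The lower bound on Cemb is multiplied by V_u^{1/2}. *)
have KP u : V u `^ 2^-1 <= Cemb * Ktilde a b u.
  have volE : \prod_j (b ord0 j - a ord0 j) = V (~: u) * V u.
    rewrite (bigID (mem u))/= mulrC; congr (_ * _).
    by apply: eq_bigl => j; rewrite inE.
  rewrite volE powRM// in C1.
  have sqV : V u = V u `^ 2^-1 * V u `^ 2^-1.
    by rewrite -expr2 -powR_mulrn ?powR_ge0// -powRrM mulVf ?pnatr_eq0// powRr1.
  rewrite /Ktilde -/(V (~: u)) -/(V u).
  apply: (@le_trans _ _ (Cemb * (V (~: u) `^ 2^-1 * V u `^ 2^-1) * V u `^ 2^-1)).
    by rewrite ler_peMl ?powR_ge0.
  rewrite -mulrA ler_wpM2l// -mulrA -sqV mulrAC.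
  by rewrite ler_peMr// mulr_ge0 ?powR_ge0.
split; first exact: error_bound.
move=> len1; apply: error_bound => // u.
apply: le_trans (KP u) _; rewrite ler_wpM2l// /Ktilde -/(V (~: u)) -/(V u).
have V1 A : V A <= 1 by apply: prodr_ile1 => j _; exact: len1.
rewrite mulrAC ler_piMl ?powR_ge0//.
have sq1 : V (~: u) `^ 2^-1 <= 1.
  have one1 : 1 `^ 2^-1 = 1 :> R by rewrite powR1.
  by rewrite -[leRHS]one1; apply: ge0_ler_powR; rewrite ?nnegrE ?invr_ge0.
by rewrite mulr_ile1 ?powR_ge0.
Qed.
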